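(* Let $a,b$ be relatively prime positive integers. Suppose that $\delta(P)$ is determined uniquely by $\zeta(P)$ for all $P\in\mathfrak{D}_{a,b}$, i.e. that $\zeta(P)=\zeta(\tilde P)$ implies $\delta(P)=\delta(\tilde P)$ for all $P,\tilde P\in\mathfrak{D}_{a,b}$. Then the map $\zeta:\mathfrak{D}_{a,b}\to\mathfrak{D}_{a,b}$ is invertible. In such case, for $Q=\zeta(P)$ the inverse path $P$ is determined from the permutation $\gamma(P)$, which is given as follows. Let $Q=Q_1,\dots,Q_l$ be the list of successive $\zeta$-predecessors of $Q$, with $Q_l$ the path having all boxes above the main diagonal below it (i.e. $Q_l$ consists of $a$ north steps followed by $b$ east steps), and let $\delta_i$ be the $\delta$-statistic corresponding to $Q_i$, i.e. $\delta_i=\delta(\zeta^{-1}(Q_i))$. Then $$\gamma(P)=\rho\,\gamma_0\,\rho^{-1},\qquad \rho=\rho_{1,\delta_1}\rho_{1,\delta_2}\cdots\rho_{1,\delta_{l-1}},$$ where $\rho_{1,i}$ is the permutation with cycle notation $(1,2,\dots,i)$ and $\gamma_0=\gamma(P_0)$. Writing $\gamma(P)$ in cycle notation as $(\sigma_1,\dots,\sigma_{a+b})$ with $\sigma_1=1$, the east steps of $P$ are exactly the $i$-th steps for which $i$ is a cyclic descent of the sequence $\sigma_1,\dots,\sigma_{a+b}$.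
   Context: An $(a,b)$-Dyck path is a lattice path from $(0,0)$ to $(b,a)$ with unit north steps and unit east steps, all of whose lattice points $(x,y)$ satisfy $ax\le by$; it is drawn in the grid with $a$ rows and $b$ columns. $\mathfrak{D}_{a,b}$ is the set of all of them. Levels: the level of the lattice point $(x,y)$ is $by-ax$. The reading word $L(P)=(l_1,\dots,l_{a+b})$ lists the levels of the lattice points along $P$ from $(0,0)$ to $(b,a)$, excluding the final point $(b,a)$ (so $l_1=0$; all entries are distinct). The reading permutation $\sigma(P)$ of $\{1,\dots,a+b\}$, in one-line notation, records the relative order of the entries of $L(P)$. $\gamma(P)$ is the $(a+b)$-cycle $(\sigma_1,\sigma_2,\dots,\sigma_{a+b})$ in cycle notation, where $\sigma(P)=[\sigma_1,\dots,\sigma_{a+b}]$ (so $\sigma_1=1$ and $\gamma(P)(\sigma_i)=\sigma_{i+1}$). A cyclic descent of $\sigma$ is an index $i$ with $\sigma_i>\sigma_{i+1}$, indices modulo $a+b$. $\delta(P)$ is the number of entries $l_i$ of $L(P)$ with $l_i<a+b$. Permutations are multiplied as functions (right factor applied first). Hooks and cores: the unit box with southeast corner $(x,y)$ has hook filling $by-ax$. The positive hooks of $P$ are the positive hook fillings of the boxes of the grid below (southeast of) $P$; $\mathrm{area}(P)$ is their number. $P_0$ is the diagonal path, the unique $(a,b)$-Dyck path of area $0$. $\mathfrak{c}(P)$ is the partition whose set of first-column hook lengths is the set of positive hooks of $P$ (it has no hook length equal to $a$ or $b$). For a partition $\kappa$ and a positive integer $m$: for each residue modulo $m$ occurring among the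 first-column hook lengths of $\kappa$ take the largest such hook length; the rows with these first-column hook lengths are the $m$-rows of $\kappa$; the $m$-boundary is the set of boxes with hook length less than $m$. Zeta: $\lambda(P)=(\lambda_1\ge\dots\ge\lambda_a)$ has as parts the numbers of $b$-boundary boxes in the $a$-rows of $\mathfrak{c}(P)$ (padded with zeros). $\zeta(P)$ is the $(a,b)$-Dyck path such that the boxes of the grid above (northwest of) it form the Young diagram of $\lambda(P)$ (English notation). Conjugation: $P^c$ is obtained by applying cyclic shifts to the step sequence of $P$ until a path lying strictly below the diagonal (except at its endpoints) is obtained (there is exactly one such cyclic shift), and rotating it by $180^\circ$. Predecessors: the maximal box of a path $P$ of positive area is the box under the peak of $P$ of maximal level (the box whose northwest corner is the lattice point of $P$ of maximal level). For $P$ of positive area let $P'$ be the conjugate of the path obtained from $P^c$ by removing its maximal box (i.e. making that box lie above the path). The $\zeta$-predecessor of $Q=\zeta(P)$ is $Q'=\zeta(P')$. The list of $\zeta$-predecessors of $Q=\zeta(P)$ is obtained by iterating $P\mapsto P'$ until the diagonal path $P_0$ is reached and applying $\zeta$; its first element is $Q_1=Q$ and its last is $Q_l=\zeta(P_0)$. *)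

(* Defs.v *)
From mathcomp Require Import all_boot all_order all_fingroup all_algebra.
Set Implicit Arguments.
Unset Strict Implicit.
Unset Printing Implicit Defensive.
Import Order.TTheory GRing.Theory Num.Theory.

(** ** Lattice paths

    A lattice path starting at (0,0) is its step sequence; the lattice points
    along [w] are numbered from [0] to [size w]. *)

Notation north := true (only parsing).
Notation east := false (only parsing).

Definition xcoord (w : seq bool) (i : nat) : nat := count_mem east (take i w).
Definition ycoord (w : seq bool) (i : nat) : nat := count_mem north (take i w).

Definition dyck_path (a b : nat) (w : seq bool) : bool :=
  [&& count_mem north w == a, count_mem east w == b
    & all (fun i => a * xcoord w i <= b * ycoord w i) (iota 0 (size w).+1)].

Definition dyck_paths (a b : nat) : {pred seq bool} := dyck_path a b.

(** ** Levels, reading word, reading permutation *)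

Definition level (a b x y : nat) : int := ((b * y)%:Z - (a * x)%:Z)%R.

Definition reading_word (a b : nat) (w : seq bool) : seq int :=
  [seq level a b (xcoord w i) (ycoord w i) | i <- iota 0 (size w)].

Definition reading_perm (a b : nat) (w : seq bool) : seq nat :=
  let L := reading_word a b w in [seq (count (fun m => m < l)%R L).+1 | l <- L].

Definition delta (a b : nat) (w : seq bool) : nat :=
  count (fun l => l < (a + b)%:Z)%R (reading_word a b w).

(** ** Permutations of {1, ..., n}

    They are represented as permutations of {0, 1, ..., n} = ['I_n.+1] which fix
    the extra element [0], so that the entries keep their usual names. *)

Lemma next_undup_inj (T : eqType) (c : seq T) : injective (next (undup c)).
Proof. exact: can_inj (prev_next (undup_uniq c)). Qed.

(** The permutation with cycle notation [c]; [undup] is the identity on every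
    duplicate-free [c] and only serves to make this a total function. *)
Definition cycle_perm (n : nat) (c : seq nat) : 'S_n.+1 :=
  perm (@next_undup_inj _ [seq inord i | i <- c]).

(** The product of permutations as functions: the right factor is applied first
    (whereas [s * t] in the group ['S_n] applies [s] first). *)
Definition perm_comp (n : nat) (s t : 'S_n) : 'S_n := (t * s)%g.

(** The sequence [1, g 1, g (g 1), ...] of length [n]. *)
Definition cycle_notation (n : nat) (g : 'S_n.+1) : seq nat :=
  [seq val x | x <- traject g (inord 1) n].

Definition rho1 (n i : nat) : 'S_n.+1 := cycle_perm n (iota 1 i).

Definition gamma (a b : nat) (w : seq bool) : 'S_(a + b).+1 :=
  cycle_perm (a + b) (reading_perm a b w).

(** Indices are counted from [0]. *)
Definition cyclic_descent (s : seq nat) (i : nat) : bool :=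
  nth 0 s (i.+1 %% size s) < nth 0 s i.

(** ** Hooks and cores *)

(** [heights w] lists the heights of the successive east steps of [w]: the box
    with southeast corner [(x, y)] lies below [w] iff [y < nth 0 (heights w) x.-1]. *)
Definition heights (w : seq bool) : seq nat :=
  [seq ycoord w i | i <- iota 0 (size w) & nth north w i == east].

Definition positive_hooks (a b : nat) (w : seq bool) : seq nat :=
  [seq `|level a b p.1 p.2|%N
     | p <- [seq (x, y) | x <- iota 1 b, y <- iota 0 a]
     & (p.2 < nth 0 (heights w) p.1.-1) && (0 < level a b p.1 p.2)%R].

Definition area (a b : nat) (w : seq bool) : nat := size (positive_hooks a b w).

(** The unique path of area [0]. *)
Definition diagonal_path (a b : nat) : seq bool :=
  if [pick w : (a + b).-tuple bool
        | (tval w \in dyck_paths a b) && (area a b w == 0)]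
  is Some w then tval w else [::].

(** Partitions are weakly decreasing sequences; rows and columns are numbered
    from [0]. *)
Definition conj_part (kappa : seq nat) (j : nat) : nat := count (ltn j) kappa.

Definition hook_length (kappa : seq nat) (i j : nat) : nat :=
  (nth 0 kappa i - j.+1) + (conj_part kappa j - i.+1) + 1.

Definition first_column_hooks (kappa : seq nat) : seq nat :=
  [seq hook_length kappa i 0 | i <- iota 0 (size kappa)].

(** The partition with first-column hook lengths [H], a strictly decreasing
    sequence of positive integers (see [partition_of_hooksK]). *)
Definition partition_of_hooks (H : seq nat) : seq nat :=
  [seq nth 0 H i - (size H - i.+1) | i <- iota 0 (size H)].

Lemma partition_of_hooksK (H : seq nat) :
  sorted gtn H -> all (ltn 0) H -> first_column_hooks (partition_of_hooks H) = H.
Proof.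
move=> sH pH; have Hge i : i < size H -> size H - i <= nth 0 H i.
  elim: H sH pH i => [|h H IH] //= pth /andP[h0 H0] [|i] iH /=; last first.
    by rewrite subSS; apply: IH => //; apply: path_sorted pth.
  rewrite subn0; case: H IH pth H0 {iH} => [|k H] //= IH /andP[hk pth] H0.
  exact: leq_ltn_trans (IH pth H0 0 isT) hk.
rewrite /first_column_hooks size_map size_iota -[RHS](mkseq_nth 0).
apply/eq_in_map => i; rewrite mem_iota /= add0n => iH.
rewrite /hook_length (nth_map 0) ?size_iota // nth_iota // add0n.
have -> : conj_part (partition_of_hooks H) 0 = size H.
  rewrite /conj_part /partition_of_hooks count_map -[RHS](size_iota 0).
  apply/eqP; rewrite -all_count; apply/allP => j; rewrite mem_iota /= add0n => jH.
  by rewrite /= subn_gt0; apply: leq_trans (Hge _ jH); rewrite -subSn // subSS.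
have lt : size H - i.+1 < nth 0 H i.
  by apply: leq_trans (Hge _ iH); rewrite -subSn // subSS.
by rewrite addnAC subn1 addn1 prednK ?subn_gt0 // subnK // ltnW.
Qed.

Definition core (a b : nat) (w : seq bool) : seq nat :=
  partition_of_hooks (sort geq (positive_hooks a b w)).

Definition is_mrow (m : nat) (kappa : seq nat) (i : nat) : bool :=
  let H := first_column_hooks kappa in
  all (fun h => (h == nth 0 H i %[mod m]) ==> (h <= nth 0 H i)) H.

(** The number of boxes of the [m]-boundary in row [i]. *)
Definition mboundary (m : nat) (kappa : seq nat) (i : nat) : nat :=
  count (fun j => hook_length kappa i j < m) (iota 0 (nth 0 kappa i)).

(** ** The zeta map *)

Definition lambda (a b : nat) (w : seq bool) : seq nat :=
  let kappa := core a b w in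
  let parts :=
    [seq mboundary b kappa i | i <- iota 0 (size kappa) & is_mrow a kappa i] in
  sort geq (parts ++ nseq (a - size parts) 0).

(** The path in the grid with [size lam] rows and [b] columns such that the boxes
    northwest of it form [lam] (English notation, first part on top): before the
    north step of each row, the path has made as many east steps as the
    corresponding part; the rows are met from bottom to top. *)
Definition path_below (b : nat) (lam : seq nat) : seq bool :=
  let mu := rev lam in
  flatten (pairmap (fun p q => rcons (nseq (q - p) east) north) 0 mu)
    ++ nseq (b - last 0 mu) east.

Definition zeta (a b : nat) (w : seq bool) : seq bool := path_below b (lambda a b w).

(** ** Conjugation and predecessors *)

Definition strictly_below (a b : nat) (w : seq bool) : bool :=
  all (fun i => b * ycoord w i < a * xcoord w i) (iota 1 (size w).-1).

(** Rotating by 180 degrees reverses the step sequence. *)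
Definition conj_path (a b : nat) (w : seq bool) : seq bool :=
  rev (rot (find (fun k => strictly_below a b (rot k w)) (iota 0 (size w))) w).

(** The index of the lattice point of maximal level: the end of a north step
    followed by an east step. *)
Definition max_index (a b : nat) (w : seq bool) : nat :=
  let L := reading_word a b w in find (fun l => all (fun m => m <= l)%R L) L.

Definition remove_max_box (a b : nat) (w : seq bool) : seq bool :=
  let i := max_index a b w in take i.-1 w ++ [:: east; north] ++ drop i.+1 w.

(** The path [P'] attached to a path [P] of positive area. *)
Definition pred_path (a b : nat) (P : seq bool) : seq bool :=
  conj_path a b (remove_max_box a b (conj_path a b P)).

(** [zeta_predecessors a b P Qs]: [Qs] is the list of zeta-predecessors of
    [zeta a b P]. *)
Inductive zeta_predecessors (a b : nat) : seq bool -> seq (seq bool) -> Prop :=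
| zeta_predecessors_diag :
    zeta_predecessors a b (diagonal_path a b) [:: zeta a b (diagonal_path a b)]
| zeta_predecessors_step (P : seq bool) (Qs : seq (seq bool)) :
    0 < area a b P -> zeta_predecessors a b (pred_path a b P) Qs ->
    zeta_predecessors a b P (zeta a b P :: Qs).

(* Main.v *)
Require Import Defs.
From mathcomp Require Import all_boot all_order all_fingroup all_algebra.
From mathcomp Require Import zify.
Set Implicit Arguments.
Unset Strict Implicit.
Unset Printing Implicit Defensive.
Import Order.TTheory GRing.Theory Num.Theory.

(** A path is best seen as a cyclic sequence of levels: a north step adds [b] to
    the level, an east step subtracts [a], and the path ends at level 0 where it
    began. Modulo [a + b] every step adds [b], which is coprime to [a + b], so
    the levels of the first [a + b] points are distinct even modulo [a + b]
    ([lev_inj_mod]). The permutation gamma sends the rank of the level of a point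
    to the rank of the level of the next point; it does not see where the cycle
    is cut, nor a translation of all levels ([gamma_rot]).

    Zeta sorts the steps by the level of their starting point, so the north steps
    of [zeta P] are the exceedances of [gamma P] ([zeta_exceedances]). Indeed the
    [a]-rows of the core are given by the boxes just to the right of the north
    steps, and the boxes of the [b]-boundary in the row of hook [h] are the
    numbers of the window from [h - b + 1] to [h - 1] that are not hooks. Each
    class modulo [b] is the class of one column, and it contributes to the window
    exactly when the east step of that column starts at a lower level than the
    north step ([gap_count]).

    Conjugation negates and reverses the cycle of levels. The maximal box of the
    conjugate of [P] therefore sits at the point of [P] of level 0, and removing
    it moves this point to level [a + b]. On words, [P = N v E] becomes a cyclic
    shift of [E v N] ([pred_path_rot]). The rank of the moved point changes from
    1 to [delta P], and the ranks in between drop by one, so that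
    [gamma P = rho gamma(P') rho^-1] with [rho] the cycle [(1, 2, .., delta P)]
    ([gamma_pred]). For the same reason [zeta P'] can be computed from [zeta P]
    and [delta P] alone ([exceedances_pred]).

    The maximal level strictly decreases from [P] to [P'] as long as some level
    exceeds [a + b], that is, as long as the area is positive ([area_gt0P],
    [pred_path_bound]); and there is only one path all of whose levels are below
    [a + b], the diagonal path. This gives an induction along predecessors
    ([dyck_pred_ind]). If [zeta P = zeta R], then [delta P = delta R] by
    assumption, hence [zeta P' = zeta R'], hence [P' = R'] by induction, hence
    [gamma P = gamma R]. But [gamma P], read from 1, is the reading permutation,
    whose cyclic descents are the east steps of [P]; so [P = R]. Since zeta maps
    the finite set of Dyck paths into itself ([exceedances_dyck]), it is
    bijective, and unfolding the relation between [gamma P] and [gamma P'] down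
    to the diagonal path gives the formula for [gamma P]. *)

(** * Coordinates along a word, and arithmetic preliminaries *)

Lemma nsteps w : count_mem east w + count_mem north w = size w.
Proof.
rewrite addnC -(count_predC (pred1 north)); congr (_ + _).
by apply: eq_count; case.
Qed.

Lemma coordD w i : i <= size w -> xcoord w i + ycoord w i = i.
Proof. by move=> iw; rewrite /xcoord /ycoord nsteps size_takel. Qed.

Lemma coordS w i : i < size w ->
  xcoord w i.+1 = xcoord w i + (nth north w i == east) /\
  ycoord w i.+1 = ycoord w i + (nth north w i == north).
Proof.
by move=> iw; rewrite /xcoord /ycoord !(take_nth north) // -!cats1 !count_cat /= !addn0.
Qed.

Lemma count_ltn (T : eqType) (p q : pred T) (s : seq T) x :
  subpred p q -> x \in s -> ~~ p x -> q x -> count p s < count q s.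
Proof.
move=> pq /perm_to_rem/seq.permP E npx qx.
by rewrite !E /= (negbTE npx) qx add0n add1n ltnS; apply: sub_count.
Qed.

Lemma count_take (w : seq bool) c i : i <= size w ->
  count_mem c (take i w) = count (fun j => nth north w j == c) (iota 0 i).
Proof. by move=> iw; rewrite -(map_nth_iota0 north iw) count_map. Qed.

Lemma nth_filter_iota (p : pred nat) m i : i < m -> p i ->
  nth 0 (filter p (iota 0 m)) (count p (iota 0 i)) = i.
Proof.
move=> im pi; rewrite -(subnKC (ltnW im)) iotaD filter_cat nth_cat size_filter ltnn subnn add0n.
by rewrite -(prednK (n := m - i)) ?subn_gt0 //= pi.
Qed.

Lemma nth_heights (w : seq bool) i : i < size w -> ~~ nth north w i ->
  nth 0 (heights w) (xcoord w i) = ycoord w i.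
Proof.
move=> iw ei; rewrite /heights {1}/xcoord count_take 1?ltnW //.
have pe : nth north w i == east by rewrite eqbF_neg.
rewrite (nth_map 0) ?nth_filter_iota // size_filter.
rewrite -(subnKC (ltnW iw)) iotaD count_cat add0n -[X in X < _]addn0 ltn_add2l.
by rewrite -(prednK (n := size w - i)) ?subn_gt0 //= pe.
Qed.

Lemma coord_mono (w : seq bool) i j : i <= j ->
  (xcoord w i <= xcoord w j) /\ (ycoord w i <= ycoord w j).
Proof.
move=> ij; rewrite /xcoord /ycoord -(take_takel w ij).
by rewrite -{2 4}(cat_take_drop i (take j w)) !count_cat !leq_addr.
Qed.

(** Take the first prefix that contains more than [x] letters [c]. *)
Lemma ex_step (w : seq bool) c x : x < count_mem c w ->
  exists i, [/\ i < size w, nth north w i = c & count_mem c (take i w) = x].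
Proof.
move=> xw; have ex : exists m, x < count_mem c (take m w) by exists (size w); rewrite take_size.
case: (ex_minnP ex) => -[|i]; first by rewrite take0.
case: (ltnP i (size w)) => iw; last first.
  by rewrite (take_oversize (leqW iw)) => _ /(_ i); rewrite (take_oversize iw) xw ltnn => /(_ isT).
rewrite (take_nth north) // -cats1 count_cat /= addn0 => xi /(_ i) min.
have {min} : count_mem c (take i w) <= x by rewrite leqNgt; apply/negP => /min; rewrite ltnn.
move: xi; case: eqP => [E|_] /=; last by rewrite addn0 ltnNge => /negP.
rewrite addn1 ltnS => xi xl; exists i; split=> //.
by apply/eqP; rewrite eqn_leq xl xi.
Qed.

(** The form in which coprimality is used: levels and hooks are combinations of
    [a] and [b], so congruences between them determine one coordinate. *)
Lemma coprime_cancel m c x y : coprime m c -> x < m -> y < m ->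
  (exists z : int, (c * x)%:Z = (c * y)%:Z + z * m%:Z)%R -> x = y.
Proof.
move=> cmc xm ym [z E].
have cz : coprimez m%:Z c%:Z by rewrite /coprimez /gcdz !absz_nat.
have : (m%:Z %| (c%:Z * (x%:Z - y%:Z))%R)%Z.
  by apply/dvdzP; exists z; move: E; lia.
rewrite Gauss_dvdzr // => /dvdzP[q].
have : ((q == 0) || (1 <= q) || (q <= -1))%R by lia.
by case/orP=> [/orP[/eqP->|q1]|q1]; [lia | nia | nia].
Qed.

(** The left-hand side is the largest number below [h] that is congruent to [e];
    it is the only member of its class in the window of [d] numbers just below [h]. *)
Lemma round_mod d e g h : e <= g -> g < h -> h < g + d -> e = g %[mod d] ->
  e + d * ((h.-1 - e) %/ d) = g.
Proof.
move=> eg gh hg E; have d0 : 0 < d by lia.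
have dg : d %| g - e by rewrite -eqn_mod_dvd // E.
rewrite (_ : h.-1 - e = g - e + (h.-1 - g)); last lia.
by rewrite divnDl // mulnDr mulnC divnK // divn_small; lia.
Qed.

(** * Permutations given by a cycle *)

Lemma next_uniq_nth (T : eqType) (x : T) (p : seq T) i : uniq p -> i < size p ->
  next p (nth x p i) = nth x p (i.+1 %% size p).
Proof.
move=> up ip; rewrite next_nth mem_nth // index_uniq //.
case: p up ip => //= y p up; rewrite ltnS leq_eqVlt => /orP[/eqP ->|ip].
  by rewrite modnn nth_default.
by rewrite modn_small //=; apply: set_nth_default.
Qed.

Lemma inord_inj_le n (r s : nat) : r <= n -> s <= n -> inord r = inord s :> 'I_n.+1 -> r = s.
Proof. by move=> rn sn /(congr1 val); rewrite /= !inordK. Qed.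

Lemma map_inord_uniq n (c : seq nat) : uniq c -> all (fun r => r <= n) c ->
  uniq [seq inord r : 'I_n.+1 | r <- c].
Proof.
move=> uc /allP cn; rewrite map_inj_in_uniq // => r s /cn rn /cn sn.
exact: inord_inj_le.
Qed.

Lemma cycle_perm_nth n (c : seq nat) i : uniq c -> all (fun r => r <= n) c ->
  i < size c -> cycle_perm n c (inord (nth 0 c i)) = inord (nth 0 c (i.+1 %% size c)).
Proof.
move=> uc cn ic; have um := map_inord_uniq uc cn.
rewrite /cycle_perm permE undup_id // -!(nth_map 0 (inord 0 : 'I_n.+1)) ?ltn_pmod //.
- by rewrite next_uniq_nth ?size_map.
- exact: leq_ltn_trans ic.
Qed.

(** Conjugating a cycle by [s] relabels its entries by [s]; [f] is [s] read on the
    natural numbers. *)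
Lemma cycle_perm_conj n (s : 'S_n.+1) (f : nat -> nat) (c : seq nat) :
  uniq c -> all (fun r => r <= n) c ->
  {in c, forall r, s (inord r) = inord (f r)} ->
  cycle_perm n [seq f r | r <- c] = (cycle_perm n c ^ s)%g.
Proof.
move=> uc cn sf; have um := map_inord_uniq uc cn; apply/permP => x.
rewrite -(permKV s x) permJ /cycle_perm !permE.
have -> : [seq inord i | i <- [seq f r | r <- c]] =
    [seq s i | i <- [seq (inord r : 'I_n.+1) | r <- c]].
  by rewrite -!map_comp; apply/eq_in_map => r /sf /= ->.
rewrite !undup_id ?(map_inj_uniq perm_inj) //.
by rewrite (next_map (@perm_inj _ s)).
Qed.

Lemma cycle_perm_rot n (c : seq nat) k : uniq c -> all (fun r => r <= n) c ->
  cycle_perm n (rot k c) = cycle_perm n c.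
Proof.
move=> uc cn; have um := map_inord_uniq uc cn; apply/permP => x.
by rewrite /cycle_perm !permE map_rot !undup_id ?rot_uniq // next_rot.
Qed.

(** The cycle [(1, 2, .., d)] on natural numbers. *)
Definition rho_val (d r : nat) : nat :=
  if r == d then 1 else if r < d then r.+1 else r.

Lemma rho1_inord n d r : 0 < d <= n -> 0 < r <= n -> rho1 n d (inord r) = inord (rho_val d r).
Proof.
move=> /andP[d0 dn] /andP[r0 rn].
have un : uniq (iota 1 d) by exact: iota_uniq.
have al : all (fun r => r <= n) (iota 1 d).
  by apply/allP => s; rewrite mem_iota add1n ltnS => /andP[_ /leq_trans]; apply.
rewrite /rho_val /rho1; case: (leqP r d) => rd.
  have {1}-> : r = nth 0 (iota 1 d) r.-1 by rewrite nth_iota; lia.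
  rewrite cycle_perm_nth ?size_iota //; last lia.
  rewrite prednK //; case: eqP => [->|rd']; first by rewrite modnn nth_iota.
  have {rd rd'}rd : r < d by lia.
  by rewrite rd modn_small ?nth_iota ?add1n.
rewrite gtn_eqF // ifN -?leqNgt ?(ltnW rd) //.
rewrite /cycle_perm permE next_nth ifN // mem_undup; apply/mapP => -[s].
rewrite mem_iota => sd /(@inord_inj_le n r s rn); lia.
Qed.

(** * Boxes of a partition as gaps between its first-column hooks *)

Section BetaNumbers.
Variable H : seq nat.
Hypothesis H_sorted : sorted gtn H.
Implicit Types (g i j t : nat).

Definition gaps t : nat := count (fun g => g \notin H) (iota 0 t).

Lemma gaps_mono t u : t <= u -> gaps t <= gaps u.
Proof. by move=> tu; rewrite /gaps -(subnKC tu) iotaD count_cat leq_addr. Qed.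

Lemma gapsS t : gaps t.+1 = gaps t + (t \notin H).
Proof. by rewrite /gaps -addn1 iotaD count_cat /= addn0. Qed.

Lemma gtn_sorted_uniq : uniq H.
Proof. by apply: sorted_uniq H_sorted; [move=> x y z; lia | move=> x; rewrite /= ltnn]. Qed.

Lemma gapsE t : gaps t + count (fun h => h < t) H = t.
Proof.
rewrite /gaps -[in RHS](size_iota 0 t) -(count_predC (fun g => g \notin H)); congr (_ + _).
rewrite -!size_filter; apply/perm_size/uniq_perm; rewrite ?filter_uniq ?iota_uniq ?gtn_sorted_uniq //.
by move=> h; rewrite !mem_filter mem_iota /= negbK andbC.
Qed.

Lemma count_nth_lt i : i < size H -> count (fun h => h < nth 0 H i) H = size H - i.+1.
Proof.
move=> iH; rewrite -[X in count _ X](mkseq_nth 0) /mkseq count_map.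
rewrite -[X in iota 0 X](subnKC iH) iotaD count_cat.
have gtr : transitive gtn by move=> x y z; lia.
have lt k l : k < size H -> l < size H -> k < l -> nth 0 H l < nth 0 H k.
  by move=> kH lH; apply: (sorted_ltn_nth gtr 0 H_sorted).
rewrite (@eq_in_count _ _ pred0) ?count_pred0; last first.
  move=> k; rewrite mem_iota add0n => /= ki; apply/negbTE; rewrite -leqNgt.
  move: ki; rewrite ltnS leq_eqVlt => /orP[/eqP -> //|ki].
  by apply/ltnW/lt => //; lia.
rewrite (@eq_in_count _ _ predT) ?count_predT ?size_iota // => k.
by rewrite mem_iota add0n => /= ki; apply: lt => //; lia.
Qed.

(** The number of hooks below the [i]-th one only depends on [i], which turns
    counting gaps below a hook into a subtraction. *)
Lemma gaps_nth i : i < size H -> gaps (nth 0 H i) + (size H - i.+1) = nth 0 H i.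
Proof. by move=> iH; rewrite -{2}(gapsE (nth 0 H i)) count_nth_lt. Qed.

Lemma partition_of_hooks_gaps : partition_of_hooks H = [seq gaps h | h <- H].
Proof.
rewrite -[in RHS](mkseq_nth 0 H) /mkseq -map_comp; apply/eq_in_map => i.
by rewrite mem_iota => /= iH; rewrite -{1}(gaps_nth iH) addnK.
Qed.

(** Columns are numbered by gaps: column [j] corresponds to the gap with exactly
    [j] gaps below it. *)
Lemma iota_gaps t : iota 0 (gaps t) = [seq gaps g | g <- iota 0 t & g \notin H].
Proof.
elim: t => [|t IH] //; rewrite gapsS -(addn1 t) [in RHS]iotaD filter_cat map_cat -IH.
by case: (boolP (t \in H)) => tH; rewrite ?addn0 ?cats0 //= tH ?cats0 // iotaD.
Qed.

(** The rows that reach the column of a gap [g] are those whose hook exceeds [g]. *)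
Lemma conj_part_gaps g : g \notin H ->
  conj_part (partition_of_hooks H) (gaps g) + (g - gaps g) = size H.
Proof.
move=> gH; have gE : g - gaps g = count (fun h => h < g) H by rewrite -{1}(gapsE g) addKn.
rewrite gE /conj_part partition_of_hooks_gaps count_map addnC.
rewrite -(count_predC (fun h => h < g)); congr (_ + _).
apply: eq_in_count => h hH /=; rewrite -leqNgt.
case: (ltngtP g h) => [gh|hg|E]; last by rewrite E hH in gH.
  by apply: leq_trans (gaps_mono gh); rewrite gapsS gH addn1.
by apply/negbTE; rewrite -leqNgt gaps_mono // ltnW.
Qed.

(** The classical description of hook lengths by beta-numbers: in the row of hook
    [h], they are the differences [h - g] for the gaps [g] below [h]. *)
Lemma hook_length_gaps i g : i < size H -> g < nth 0 H i -> g \notin H ->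
  hook_length (partition_of_hooks H) i (gaps g) = nth 0 H i - g.
Proof.
move=> iH gi gH; rewrite /hook_length {1}partition_of_hooks_gaps (nth_map 0) //.
have := gaps_nth iH; have := conj_part_gaps gH; have := gaps_mono gi.
have := gapsE g; have := gapsE (nth 0 H i); have := count_nth_lt iH.
have : count (fun h => h < g) H <= count (fun h => h < nth 0 H i) H.
  by apply: sub_count => h /= hg; apply: ltn_trans gi.
rewrite gapsS gH; lia.
Qed.

(** By [iota_gaps] and [hook_length_gaps], a row may be summed over gaps instead of
    columns. *)
Lemma mboundary_gaps m i : i < size H ->
  mboundary m (partition_of_hooks H) i =
  count (fun g => (g \notin H) && (nth 0 H i < g + m)) (iota 0 (nth 0 H i)).
Proof.
move=> iH; rewrite /mboundary {2}partition_of_hooks_gaps (nth_map 0) // iota_gaps.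
rewrite count_map count_filter; apply: eq_in_count => g; rewrite mem_iota add0n => /= gi.
rewrite andbC; case: (boolP (g \in H)) => //= gH.
by rewrite hook_length_gaps //; lia.
Qed.

End BetaNumbers.

Lemma size_partition_of_hooks H : size (partition_of_hooks H) = size H.
Proof. by rewrite size_map size_iota. Qed.

(** A word is determined by the number of east steps before each north step and
    by its total number of east steps. *)
Lemma path_below_easts (q : seq bool) :
  path_below (count_mem east q)
    (rev [seq xcoord q k | k <- iota 0 (size q) & nth north q k]) = q.
Proof.
rewrite /path_below revK.
pose f p r := rcons (nseq (r - p) east) north.
suff E p : flatten (pairmap f p [seq p + xcoord q k | k <- iota 0 (size q) & nth north q k]) ++
    nseq (p + count_mem east q -
      last p [seq p + xcoord q k | k <- iota 0 (size q) & nth north q k]) east = q.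
  by have := E 0; rewrite -[RHS]/q.
elim: q p => [|x q IH] p; first by rewrite /= addn0 subnn.
have S c : [seq p + xcoord (c :: q) k | k <- iota 1 (size q) & nth north (c :: q) k] =
  [seq p + ((c == east) + xcoord q k) | k <- iota 0 (size q) & nth north q k].
  rewrite -[1]/(1 + 0) iotaDl filter_map -map_comp.
  by apply: eq_map.
case: x; rewrite /= S.
  rewrite /= /f /xcoord /= addn0 subnn /=; congr (_ :: _).
  exact: IH.
rewrite (_ : [seq p + (_ + xcoord q k) | k <- _ & _] =
  [seq p.+1 + xcoord q k | k <- iota 0 (size q) & nth north q k]); last first.
  by apply: eq_map => k /=; rewrite addnA addn1.
set L := [seq p.+1 + xcoord q k | k <- _ & _].
transitivity (east :: flatten (pairmap f p.+1 L) ++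
  nseq (p.+1 + count_mem east q - last p.+1 L) east); last first.
  by congr cons; apply: IH.
have : all (fun r => p < r) L by apply/allP => r /mapP[k _ ->]; rewrite addSn ltnS leq_addr.
case: L => [_|r s /= /andP[pr _]]; first by rewrite /= !addKn.
by rewrite /f -(subnSK pr) /= addnA addn1.
Qed.

(** * Levels *)

Section RationalDyckPaths.
Variables a b : nat.
Hypotheses (a_gt0 : 0 < a) (b_gt0 : 0 < b) (coprime_ab : coprime a b).
Implicit Types (w u v : seq bool) (i j k : nat).

Local Notation gamma := (gamma a b).
Local Notation delta := (delta a b).
Local Notation dyck := (dyck_path a b).

(** The words that are cyclic shifts of Dyck paths; conjugation and predecessors
    pass through such words. *)
Definition balanced (w : seq bool) : bool :=
  (count_mem north w == a) && (count_mem east w == b).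

Definition lev (w : seq bool) (i : nat) : int :=
  level a b (xcoord w i) (ycoord w i).

Definition rank (w : seq bool) (i : nat) : nat :=
  (count (fun j => lev w j < lev w i)%R (iota 0 (size w))).+1.

Lemma size_balanced w : balanced w -> size w = a + b.
Proof.
by case/andP=> /eqP <- /eqP <-; rewrite addnC nsteps.
Qed.

Lemma balanced_perm w u : perm_eq w u -> balanced w = balanced u.
Proof. by move=> /seq.permP wu; rewrite /balanced !wu. Qed.

Lemma lev0 w : lev w 0 = 0%R.
Proof. by rewrite /lev /xcoord /ycoord take0 /level /=; lia. Qed.

Lemma lev_north w i : i < size w -> nth north w i -> lev w i.+1 = (lev w i + b%:Z)%R.
Proof.
by move=> /coordS; rewrite /lev /level; case: (nth _ _ _) => //= -[-> ->] _; lia.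
Qed.

Lemma lev_east w i : i < size w -> ~~ nth north w i -> lev w i.+1 = (lev w i - a%:Z)%R.
Proof.
by move=> /coordS; rewrite /lev /level; case: (nth _ _ _) => //= -[-> ->] _; lia.
Qed.

Lemma lev_size w : balanced w -> lev w (size w) = 0%R.
Proof.
by case/andP=> /eqP aw /eqP bw; rewrite /lev /level /xcoord /ycoord take_size aw bw; lia.
Qed.

(** So the level is [b * i] modulo [a + b]. *)
Lemma lev_linear w i : i <= size w -> (lev w i = (b * i)%:Z - ((a + b) * xcoord w i)%:Z)%R.
Proof. by move=> /coordD; rewrite /lev /level; lia. Qed.

(** A cyclic shift changes the origin, hence translates all levels. *)
Lemma lev_rot w k i : balanced w -> k <= size w -> i < size w ->
  (lev (rot k w) i = lev w ((k + i) %% size w) - lev w k)%R.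
Proof.
move=> bw kw iw; have [aE bE] := andP bw.
have E u v : (level a b (count_mem east (u ++ v)) (count_mem north (u ++ v)) =
   level a b (count_mem east u) (count_mem north u) +
   level a b (count_mem east v) (count_mem north v))%R.
  by rewrite !count_cat /level; lia.
have T : (level a b (count_mem east w) (count_mem north w) = 0)%R.
  by rewrite (eqP aE) (eqP bE) /level; lia.
have := T; rewrite -{1 2}(cat_take_drop k w) E => Tk.
rewrite /rot /lev /xcoord /ycoord take_cat size_drop ltn_subRL.
case: ltnP => ki.
  by rewrite modn_small // takeD E; lia.
rewrite -(subnK ki) modnDr modn_small; last lia.
rewrite E (_ : i - (size w - k) = k + i - size w); last lia.
rewrite take_takel; last lia.
by lia.
Qed.

(** Reversal is rotation by 180 degrees about the midpoint of the segment between
    the two endpoints, and both endpoints have level 0. *)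
Lemma lev_rev w i : balanced w -> i <= size w ->
  (lev (rev w) i = - lev w (size w - i))%R.
Proof.
move=> bw iw; have [aE bE] := andP bw.
rewrite /lev /xcoord /ycoord take_rev !count_rev.
move: (congr1 (count_mem east) (cat_take_drop (size w - i) w)).
move: (congr1 (count_mem north) (cat_take_drop (size w - i) w)).
by rewrite !count_cat (eqP aE) (eqP bE) /level; lia.
Qed.

Lemma lev_inj_mod w i j : i < a + b -> j < a + b -> size w = a + b ->
  (exists c : int, lev w i = lev w j + c * (a + b)%:Z)%R -> i = j.
Proof.
move=> iw jw sw [c]; rewrite !lev_linear ?sw 1?ltnW // => E.
have cn : coprime (a + b) b by rewrite /coprime gcdnC gcdnDr gcdnC.
apply: (coprime_cancel cn iw jw).
by exists ((xcoord w i)%:Z - (xcoord w j)%:Z + c)%R; move: E; lia.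
Qed.

Lemma lev_inj w i j : i < a + b -> j < a + b -> size w = a + b ->
  lev w i = lev w j -> i = j.
Proof.
by move=> iw jw sw E; apply: (@lev_inj_mod w) => //; exists 0%R; rewrite mul0r addr0.
Qed.

(** * Ranks of the levels *)

Lemma reading_permE w : reading_perm a b w = [seq rank w i | i <- iota 0 (size w)].
Proof.
rewrite /reading_perm /reading_word -map_comp; apply: eq_map => i /=.
by rewrite count_map.
Qed.

Lemma nth_reading_perm w i : i < size w -> nth 0 (reading_perm a b w) i = rank w i.
Proof. by move=> iw; rewrite reading_permE (nth_map 0) ?size_iota // nth_iota. Qed.

Lemma size_reading_perm w : size (reading_perm a b w) = size w.
Proof. by rewrite reading_permE size_map size_iota. Qed.

Lemma rank_lt w i j : i < size w -> (lev w i < lev w j)%R -> rank w i < rank w j.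
Proof.
move=> iw ij; rewrite /rank ltnS.
apply: (@count_ltn _ _ _ _ i); rewrite ?mem_iota ?ltxx // => k kl.
exact: lt_trans kl ij.
Qed.

Lemma rank_ltE w i j : i < size w -> j < size w -> (rank w i < rank w j) = (lev w i < lev w j)%R.
Proof.
move=> iw jw; case: (ltgtP (lev w i) (lev w j)) => [|/rank_lt|E]; first exact: rank_lt.
  by move=> /(_ jw) ?; apply/negbTE; rewrite -leqNgt ltnW.
by rewrite /rank E ltnn.
Qed.

Lemma rank_inj w i j : size w = a + b -> i < a + b -> j < a + b ->
  rank w i = rank w j -> i = j.
Proof.
move=> sw iw jw E; apply: (@lev_inj w) => //.
by case: (ltgtP (lev w i) (lev w j)) => // /rank_lt; rewrite sw E ltnn;
  [move=> /(_ iw) | move=> /(_ jw)].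
Qed.

Lemma reading_perm_uniq w : size w = a + b -> uniq (reading_perm a b w).
Proof.
move=> sw; rewrite reading_permE map_inj_in_uniq ?iota_uniq // => i j.
by rewrite !mem_iota !add0n sw => iw jw; apply: rank_inj.
Qed.

Lemma rank_le w i : i < size w -> rank w i <= size w.
Proof.
move=> iw; rewrite -[X in _ <= X](size_iota 0) -(count_predC (fun j => (lev w j < lev w i)%R)).
rewrite /rank -addn1 leq_add2l -has_count; apply/hasP; exists i; rewrite ?mem_iota //=.
by rewrite ltxx.
Qed.

Lemma reading_perm_iota w : size w = a + b -> perm_eq (reading_perm a b w) (iota 1 (a + b)).
Proof.
move=> sw; apply: uniq_perm; rewrite ?reading_perm_uniq ?iota_uniq //.
apply: (@uniq_min_size _ (reading_perm a b w) (iota 1 (a+b)) _ _ _).2; first exact: reading_perm_uniq.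
  move=> r; rewrite reading_permE => /mapP[i]; rewrite mem_iota => /= iw ->.
  by rewrite mem_iota /= add1n ltnS -sw rank_le.
by rewrite size_reading_perm size_iota sw.
Qed.

Lemma rank_onto w r : size w = a + b -> 0 < r <= a + b ->
  exists2 i, i < a + b & rank w i = r.
Proof.
move=> sw rn; have : r \in reading_perm a b w.
  by rewrite (perm_mem (reading_perm_iota sw)) mem_iota add1n ltnS.
rewrite reading_permE => /mapP[i]; rewrite mem_iota sw => iw ->; by exists i.
Qed.

Lemma reading_perm_rot w k : balanced w -> k <= size w ->
  reading_perm a b (rot k w) = rot k (reading_perm a b w).
Proof.
move=> bw kw.
have E : reading_word a b (rot k w) = [seq (l - lev w k)%R | l <- rot k (reading_word a b w)].
  apply: (@eq_from_nth _ 0%R); first by rewrite !(size_map, size_rot, size_iota).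
  move=> i; rewrite size_map size_iota size_rot => iw.
  rewrite (nth_map 0) ?size_iota ?size_rot // nth_iota ?size_rot // add0n -/(lev _ _) lev_rot //.
  rewrite (nth_map 0%R) ?size_rot ?size_map ?size_iota //; congr (_ - _)%R.
  rewrite /rot nth_cat size_drop size_map size_iota nth_drop.
  case: ltnP => ki.
    rewrite (nth_map 0) ?size_iota ?nth_iota //; try lia.
    by rewrite modn_small //; lia.
  rewrite nth_take; last lia.
  rewrite (nth_map 0) ?size_iota ?nth_iota //; try lia.
  rewrite add0n -/(lev _ _) (_ : k + i = size w + (i - (size w - k))); last lia.
  by rewrite modnDl modn_small //; lia.
rewrite /reading_perm E -map_rot -!map_comp; apply: eq_map => l /=.
rewrite count_map; congr _.+1.
transitivity (count (fun m => m < l)%R (rot k (reading_word a b w))).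
  by apply: eq_count => m /=; rewrite ltrD2r.
by apply/seq.permP; rewrite perm_rot.
Qed.

(** * The cycle of a path and its exceedances *)

Lemma dyck_balanced w : dyck w -> balanced w.
Proof. by case/and3P=> wa wb _; rewrite /balanced wa wb. Qed.

Lemma size_dyck w : dyck w -> size w = a + b.
Proof. by move/dyck_balanced; apply: size_balanced. Qed.

Lemma dyckP w : reflect (balanced w /\ forall i, i <= a + b -> (0 <= lev w i)%R) (dyck w).
Proof.
apply: (iffP idP) => [dw|[bw p]].
  split=> [|i iw]; first exact: dyck_balanced.
  have /and3P[_ _ /allP p] := dw.
  have := p i; rewrite mem_iota size_dyck // ltnS => /(_ iw).
  by rewrite /lev /level; lia.
have /andP[wa wb] := bw; apply/and3P; split=> //; apply/allP => i.
rewrite mem_iota (size_balanced bw) add0n ltnS => /andP[_ iw].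
by have := p i iw; rewrite /lev /level; lia.
Qed.

Lemma reading_perm_le w : size w = a + b ->
  all (fun r => r <= a + b) (reading_perm a b w).
Proof.
move=> sw; apply/allP => r; rewrite (perm_mem (reading_perm_iota sw)) mem_iota.
by lia.
Qed.

Lemma gamma_rank w i : size w = a + b -> i < a + b ->
  gamma w (inord (rank w i)) = inord (rank w (i.+1 %% (a + b))).
Proof.
move=> sw iw; rewrite -!nth_reading_perm ?sw ?ltn_pmod //; last lia.
by rewrite cycle_perm_nth ?size_reading_perm ?sw ?reading_perm_uniq ?reading_perm_le.
Qed.

(** A cyclic shift of the word shifts the cycle notation. *)
Lemma gamma_rot w k : balanced w -> k <= size w -> gamma (rot k w) = gamma w.
Proof.
move=> bw kw; have sw := size_balanced bw.
by rewrite /Defs.gamma reading_perm_rot // cycle_perm_rot ?reading_perm_uniq ?reading_perm_le.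
Qed.

Lemma lev_next w i : balanced w -> i < a + b ->
  (lev w (i.+1 %% (a + b)) = lev w i + (if nth north w i then b%:Z else - a%:Z))%R.
Proof.
move=> bw iw; have sw := size_balanced bw.
have -> : lev w (i.+1 %% (a + b)) = lev w i.+1.
  case: (ltngtP i.+1 (a + b)) => [?|?|->]; [by rewrite modn_small | lia |].
  by rewrite modnn lev0 -sw lev_size.
by case: ifP => [|/negbT] N; [rewrite lev_north ?sw | rewrite lev_east ?sw].
Qed.

Lemma rank_next w i : balanced w -> i < a + b ->
  (rank w i < rank w (i.+1 %% (a + b))) = nth north w i.
Proof.
move=> bw iw; rewrite rank_ltE ?(size_balanced bw) ?ltn_pmod //; last lia.
by rewrite lev_next //; case: (nth _ _ _); lia.
Qed.

Lemma rank_bound w i : size w = a + b -> i < a + b -> 0 < rank w i <= a + b.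
Proof. by move=> sw iw; rewrite -sw rank_le // sw. Qed.

(** Letter [r] (counted from 1) is north iff [r] is an exceedance of [g]. *)
Definition exceedances (g : 'S_(a + b).+1) : seq bool :=
  [seq r < g (inord r) | r <- iota 1 (a + b)].

(** A step goes up in level iff it is a north step; gamma carries this to ranks. *)
Lemma nth_exceedances w i : balanced w -> i < a + b ->
  nth north (exceedances (gamma w)) (rank w i).-1 = nth north w i.
Proof.
move=> bw iw; have sw := size_balanced bw.
have ri := rank_bound sw iw.
rewrite (nth_map 0) ?size_iota; last lia.
have E : 1 + (rank w i).-1 = rank w i by lia.
rewrite nth_iota ?E; last lia.
rewrite gamma_rank // -rank_next // inordK //.
by have := @rank_bound w (i.+1 %% (a + b)) sw; rewrite ltn_pmod; lia.
Qed.

(** The first [k] letters belong to the steps that start at the [k] lowest points. *)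
Lemma count_exceedances w c k : balanced w -> k <= a + b ->
  count_mem c (take k (exceedances (gamma w))) =
  count (fun i => (rank w i <= k) && (nth north w i == c)) (iota 0 (a + b)).
Proof.
move=> bw kn; have sw := size_balanced bw.
rewrite /exceedances -map_take take_iota (minn_idPl kn).
have /seq.permP P : perm_eq (iota 1 k) [seq r <- reading_perm a b w | r <= k].
  apply: uniq_perm; rewrite ?iota_uniq ?filter_uniq ?reading_perm_uniq // => r.
  by rewrite mem_filter (perm_mem (reading_perm_iota sw)) !mem_iota; lia.
rewrite count_map P reading_permE sw count_filter count_map.
apply: eq_in_count => i; rewrite mem_iota add0n => /= iw; rewrite andbC; congr (_ && (_ == c)).
rewrite gamma_rank // -rank_next // inordK //.
by have := @rank_bound w (i.+1 %% (a + b)) sw; rewrite ltn_pmod; lia.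
Qed.

Lemma size_exceedances g : size (exceedances g) = a + b.
Proof. by rewrite size_map size_iota. Qed.

Lemma exceedances_balanced w : balanced w -> balanced (exceedances (gamma w)).
Proof.
move=> bw; have sw := size_balanced bw.
have E c : count_mem c (exceedances (gamma w)) = count_mem c w.
  have -> : count_mem c (exceedances (gamma w)) = count_mem c (take (a + b) (exceedances (gamma w))).
    by rewrite take_oversize ?size_exceedances.
  rewrite count_exceedances //.
  rewrite -[in RHS](mkseq_nth north w) /mkseq count_map sw.
  apply: eq_in_count => i; rewrite mem_iota => iw /=.
  by have /andP[_ ->] := @rank_bound w i sw iw.
by rewrite /balanced !E.
Qed.

(** Let [t] be the [k]-th smallest level. Truncated at [t], the levels along the
    path still start and end at the same value, and a step that starts above [t]
    cannot increase the truncated level, while for the other steps, which are the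
    first [k] letters, the truncated increase is at most the true one. Hence
    these steps have a nonnegative total increase. *)
Lemma exceedances_dyck w : balanced w -> dyck (exceedances (gamma w)).
Proof.
move=> bw; have sw := size_balanced bw.
apply/dyckP; split=> [|k kn]; first exact: exceedances_balanced.
rewrite /lev /level /xcoord /ycoord !count_exceedances //.
case: (posnP k) => [->|k0].
  by rewrite !(@eq_count _ _ pred0) ?count_pred0; first lia; move=> i.
have [|i0 i0n rk] := @rank_onto w k sw; first lia.
pose t := lev w i0.
have S i : i < a + b -> (rank w i <= k) = (lev w i <= t)%R.
  by move=> iw; rewrite -rk leqNgt rank_ltE ?sw // -leNgt.
pose cut (l : int) : int := if (l <= t)%R then l else t.
have cutL l : (cut l <= l)%R by rewrite /cut; case: (lerP l t); lia.
have cutT l : (cut l <= t)%R by rewrite /cut; case: (lerP l t); lia.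
have D m : m <= a + b -> (cut (lev w m) - cut (lev w 0) <=
    (b * count (fun i => (rank w i <= k) && (nth north w i == north)) (iota 0 m))%N%:Z -
    (a * count (fun i => (rank w i <= k) && (nth north w i == east)) (iota 0 m))%N%:Z)%R.
  elim: m => [|m IH] mn; first by rewrite /= ; lia.
  have := IH (ltnW mn); rewrite -addn1 iotaD !count_cat /= !addn0 S // add0n addn1.
  rewrite !mulnDr; move: (b * count _ _) (a * count _ _) => B A.
  have := cutL (lev w m.+1); have := cutT (lev w m.+1); move: (cut (lev w m.+1)) => c1.
  case N: (nth north w m); [rewrite lev_north ?sw // | rewrite lev_east ?sw ?N //].
    rewrite (_ : (true == false) = false) // (_ : (true == true) = true) //.
    by rewrite andbT andbF {1}/cut; case: (lerP (lev w m) t) => _ /=; lia.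
  rewrite (_ : (false == true) = false) // (_ : (false == false) = true) //.
  by rewrite andbT andbF {1}/cut; case: (lerP (lev w m) t) => _ /=; lia.
have := D (a + b) (leqnn _); rewrite -[X in cut (lev w X)]sw lev_size // lev0.
by lia.
Qed.

(** * Raising the point of level 0 *)

(** All points but the origin are lowered by [a + b], which amounts to raising the
    origin by [a + b]. *)
Lemma lev_swap v i : i <= size v ->
  (lev (east :: rcons v north) i.+1 = lev (north :: rcons v east) i.+1 - (a + b)%:Z)%R.
Proof.
move=> iv; rewrite /lev /level /xcoord /ycoord /= -!cats1 !takel_cat //.
by lia.
Qed.

Lemma deltaE w : size w = a + b ->
  delta w = count (fun j => (lev w j < (a + b)%:Z)%R) (iota 0 (a + b)).
Proof. by move=> sw; rewrite /Defs.delta /reading_word count_map sw. Qed.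

Lemma dyck_lev_gt0 w i : dyck w -> 0 < i < a + b -> (0 < lev w i)%R.
Proof.
move=> /dyckP[bw p] /andP[i0 iw]; rewrite lt0r p 1?ltnW // andbT.
apply/eqP => E; have := @lev_inj w i 0 iw.
by rewrite lev0 E (size_balanced bw); lia.
Qed.

Lemma delta_bound w : dyck w -> 0 < delta w <= a + b.
Proof.
move=> dw; rewrite deltaE ?size_dyck //; apply/andP; split; last first.
  by rewrite -[X in _ <= X](size_iota 0) count_size.
rewrite -has_count; apply/hasP; exists 0; rewrite ?mem_iota ?lev0; lia.
Qed.

Lemma rank0 w : dyck w -> rank w 0 = 1.
Proof.
move=> dw; rewrite /rank (@eq_in_count _ _ pred0) ?count_pred0 // => j.
rewrite mem_iota lev0 size_dyck // add0n => /andP[_ jw].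
by have /dyckP[_ /(_ j (ltnW jw))] /= := dw; case: ltrgt0P.
Qed.

(** The raised origin passes the points of level below [a + b], which [delta]
    counts together with the origin itself. *)
Lemma rank_swap0 v : dyck (north :: rcons v east) ->
  rank (east :: rcons v north) 0 = delta (north :: rcons v east).
Proof.
move=> dw; have := size_dyck dw; rewrite /= size_rcons => sv.
have cnt (p : pred nat) : count p (iota 0 (a + b)) = p 0 + count p (iota 1 (size v).+1).
  by rewrite -sv.
rewrite deltaE ?size_dyck // /rank [size _]/= size_rcons sv !cnt !lev0 ltxx add0n.
rewrite -addn1 addnC -sv; congr (_ + _).
apply: eq_in_count => -[|j]; rewrite mem_iota // => jv.
by rewrite lev_swap; lia.
Qed.

(** The raised origin passes the points below level [a + b], which lose one rank,
    and the other points keep theirs; no point has level exactly [a + b], because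
    levels are distinct modulo [a + b]. *)
Lemma rank_swap v i : dyck (north :: rcons v east) -> i < a + b ->
  rank (north :: rcons v east) i =
  rho_val (delta (north :: rcons v east)) (rank (east :: rcons v north) i).
Proof.
move=> dw iw; set w := north :: _ in dw *; set u := east :: _.
have := size_dyck dw; rewrite /= size_rcons => sv.
have sw : size w = a + b by exact: size_dyck.
have su : size u = a + b by rewrite /= size_rcons.
case: i iw => [|i] iw.
  by rewrite rank0 // rank_swap0 // /rho_val eqxx.
have ne : lev w i.+1 <> Posz (a + b).
  move=> E; suff: i.+1 = 0 by [].
  apply: (@lev_inj_mod w) => //; first by lia.
  by exists 1%R; rewrite lev0 E; lia.
have Lu : lev u i.+1 = (lev w i.+1 - (a + b)%:Z)%R by rewrite lev_swap //; lia.
have cnt (p : pred nat) : count p (iota 0 (a + b)) = p 0 + count p (iota 1 (size v).+1).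
  by rewrite -sv.
pose C := count (fun j => (lev w j < lev w i.+1)%R) (iota 1 (size v).+1).
have rw : rank w i.+1 = C.+2.
  by rewrite /rank sw cnt lev0 dyck_lev_gt0.
have ru : rank u i.+1 = (((a + b)%:Z < lev w i.+1)%R + C).+1.
  rewrite /rank su cnt lev0 Lu; congr (nat_of_bool _ + _).+1; first by rewrite subr_gt0.
  apply: eq_in_count => -[|j]; rewrite mem_iota // => jv.
  rewrite lev_swap; last lia.
  by rewrite ltrD2r.
have := @rank_ltE u 0 i.+1; have := @rank_ltE u i.+1 0.
rewrite rank_swap0 // -/w su lev0 Lu => /(_ iw) A1 /(_ _ iw) A2.
have {A1}A1 := A1 ltac:(lia); have {A2}A2 := A2 ltac:(lia).
rewrite /rho_val; move: A1 A2; rewrite rw ru.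
case: (ltgtP (lev w i.+1) (Posz (a + b))) => //= L A1 A2.
  have -> : ((0 + C).+1 == delta w) = false by lia.
  by rewrite ifT; lia.
have -> : ((1 + C).+1 == delta w) = false by lia.
by rewrite ifF; lia.
Qed.

Lemma gamma_swap v : dyck (north :: rcons v east) ->
  gamma (north :: rcons v east) =
  (gamma (east :: rcons v north) ^ rho1 (a + b) (delta (north :: rcons v east)))%g.
Proof.
move=> dw; have := size_dyck dw; rewrite /= size_rcons => sv.
set w := north :: _ in dw *; set u := east :: _.
have sw : size w = a + b by exact: size_dyck.
have su : size u = a + b by rewrite /= size_rcons.
rewrite /Defs.gamma; have -> : reading_perm a b w =
    [seq rho_val (delta w) r | r <- reading_perm a b u].
  rewrite !reading_permE -map_comp sw su; apply/eq_in_map => i.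
  by rewrite mem_iota => /= iw; apply: rank_swap.
apply: cycle_perm_conj; rewrite ?reading_perm_uniq ?reading_perm_le // => r ru.
rewrite rho1_inord ?delta_bound //.
by move: ru; rewrite (perm_mem (reading_perm_iota su)) mem_iota add1n ltnS.
Qed.

(** * Positive hooks and area *)

Lemma ex_max_lev w : exists2 k, k < a + b & forall i, i < a + b -> (lev w i <= lev w k)%R.
Proof.
have n0 : 0 < a + b by lia.
case: (@arg_maxP _ _ _ (Ordinal n0) xpredT (fun i : 'I_(a + b) => lev w i) isT) => k _ kmax.
by exists k => // i iw; apply: (kmax (Ordinal iw)).
Qed.

Lemma coord_end w : balanced w -> xcoord w (a + b) = b /\ ycoord w (a + b) = a.
Proof.
by move=> bw; rewrite -(size_balanced bw) /xcoord /ycoord take_size; case/andP: bw => /eqP -> /eqP ->.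
Qed.

(** The box in the column of the east step [i] and in row [y] lies below the path
    iff [y] is less than the height of that step. *)
Lemma positive_hooksP w h : dyck w ->
  reflect (0 < h /\ exists i y, [/\ i < a + b, ~~ nth north w i, y < ycoord w i
            & h + a * (xcoord w i).+1 = b * y])
    (h \in positive_hooks a b w).
Proof.
move=> dw; have bw := dyck_balanced dw; have sw := size_balanced bw.
have [_ ew] := andP bw; have [xe ye] := coord_end bw.
apply: (iffP mapP) => [[[x y]]|].
  rewrite mem_filter /= => /andP[/andP[yh l0] /allpairsP[[x' y'] /= [xb ya [Ex Ey]]]] hE; subst x' y'.
  move: xb ya; rewrite !mem_iota => xb ya; split; first by lia.
  have [|i [iw ei xi]] := @ex_step w east x.-1; first by rewrite (eqP ew); lia.
  exists i, y; rewrite -sw ei; split=> //; first by rewrite -nth_heights ?ei // /xcoord xi.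
  rewrite /xcoord xi hE prednK /=; last lia.
  by move: l0; rewrite /level /=; lia.
case=> h0 [i [y [iw ei yi E]]].
exists ((xcoord w i).+1, y); last by rewrite /= /level; lia.
rewrite mem_filter /= nth_heights ?sw // yi.
rewrite (_ : (0 < _)%R); last by rewrite /level; lia.
apply/allpairsP; exists ((xcoord w i).+1, y); split=> //=; rewrite mem_iota.
  have [|xS _] := @coordS w i; first by rewrite sw.
  have [xm _] := coord_mono w iw.
  by move: xm; rewrite xS xe (negbTE ei); lia.
have [_] := coord_mono w (ltnW iw).
by rewrite ye; move: yi; lia.
Qed.

(** The box under an east step that starts at level [l] has hook [l - (a + b)], and
    this is the largest hook of its column. *)
Lemma area_gt0P w : dyck w ->
  reflect (exists2 i, i < a + b & ((a + b)%:Z < lev w i)%R) (0 < area a b w).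
Proof.
move=> dw; have bw := dyck_balanced dw; have sw := size_balanced bw.
rewrite /area -has_predT; apply: (iffP hasP) => [[h hw _]|[i0 i0n l0]].
  have [h0 [i [y [iw ei yi E]]]] := positive_hooksP h dw hw.
  by exists i => //; rewrite /lev /level; nia.
(* A point of maximal level is a peak, hence left by an east step. *)
have [k kn kmax] := ex_max_lev w.
have lk := lt_le_trans l0 (kmax _ i0n).
have ek : ~~ nth north w k.
  apply/negP => nk; have := kmax (k.+1 %% (a + b)); rewrite ltn_pmod ?lev_next ?nk //; lia.
exists (absz (lev w k - Posz (a + b))%R) => //; apply/(positive_hooksP _ dw); split; first by lia.
move: lk; rewrite /lev /level; case yE: (ycoord w k) => [|y] lk; first by lia.
by exists k, y; rewrite ek kn yE; split=> //; lia.
Qed.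

(** * Conjugation and the predecessor of a path *)

(** A shifted word is strictly below the diagonal iff it starts at the point of
    maximal level. *)
Lemma conj_path_spec w : balanced w ->
  exists k, [/\ k < a + b, conj_path a b w = rev (rot k w)
    & forall i, i < a + b -> (lev w i <= lev w k)%R].
Proof.
move=> bw; have sw := size_balanced bw; have n0 : 0 < a + b by lia.
pose p k := strictly_below a b (rot k w).
have pE k : k < a + b -> reflect (forall i, i < a + b -> (lev w i <= lev w k)%R) (p k).
  move=> kn; have kw : k <= size w by rewrite sw ltnW.
  apply: (iffP allP) => [pk i iw|kmax i].
    have jn : (i + (a + b - k)) %% (a + b) < a + b by rewrite ltn_pmod.
    have kj : (k + (i + (a + b - k)) %% (a + b)) %% (a + b) = i.
      rewrite modnDmr (_ : k + (i + (a + b - k)) = i + (a + b)); last lia.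
      by rewrite modnDr modn_small.
    case: (posnP ((i + (a + b - k)) %% (a + b))) => [E|j0].
      by rewrite -kj E addn0 modn_small.
    have := pk ((i + (a + b - k)) %% (a + b)); rewrite mem_iota size_rot sw.
    have := @lev_rot w k ((i + (a + b - k)) %% (a + b)) bw kw.
    by rewrite sw kj => /(_ jn); rewrite {1}/lev /level; lia.
  rewrite mem_iota size_rot sw => iw; have {}iw : 0 < i < a + b by lia.
  have := @lev_rot w k i bw kw; rewrite sw => /(_ ltac:(lia)).
  have kin : (k + i) %% (a + b) < a + b by rewrite ltn_pmod.
  have := kmax _ kin; rewrite le_eqVlt => /orP[/eqP /(lev_inj kin kn sw)|L].
    case: (ltnP (k + i) (a + b)) => ki; first by rewrite modn_small //; lia.
    by rewrite -(subnK ki) modnDr modn_small; lia.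
  by rewrite {1}/lev /level; lia.
have [k kn kmax] := ex_max_lev w.
have hp : has p (iota 0 (size w)).
  by apply/hasP; exists k; [rewrite mem_iota sw | apply/pE].
have fn : find p (iota 0 (size w)) < size w by rewrite -[X in _ < X](size_iota 0) -has_find.
have := nth_find 0 hp; rewrite nth_iota // add0n => pf.
have fa : find p (iota 0 (size w)) < a + b by rewrite -[X in _ < X]sw.
by exists (find p (iota 0 (size w))); split=> //; apply/pE.
Qed.

Lemma conj_path_dyck w : balanced w -> dyck (conj_path a b w).
Proof.
move=> bw; have sw := size_balanced bw; have [k [kn -> kmax]] := conj_path_spec bw.
have br : balanced (rot k w) by rewrite (balanced_perm (u := w)) ?perm_rot.
apply/dyckP; split=> [|i iw]; first by rewrite (balanced_perm (u := w)) // perm_rev perm_rot.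
rewrite lev_rev ?size_rot ?sw //.
case: (posnP i) => [->|i0]; first by rewrite subn0 -sw -(size_rot k) lev_size.
rewrite lev_rot ?sw //; [|exact: ltnW|lia].
by have := kmax ((k + (a + b - i)) %% (a + b)); rewrite ltn_pmod; lia.
Qed.

Lemma dyck_shape w : dyck w -> exists v, w = north :: rcons v east.
Proof.
move=> dw; have sw := size_dyck dw; have [bw p] := dyckP w dw.
case: w sw bw p dw => [|x w] sw bw p dw; first by move: sw; rewrite /=; lia.
case/lastP: w sw bw p dw => [|v y] sw bw p dw; first by move: sw; rewrite /=; lia.
have sv : size v + 2 = a + b by rewrite -sw /= size_rcons; lia.
exists v; congr (_ :: rcons _ _).
  case: x {dw} sw bw p => // sw bw p; have := p 1.
  by rewrite lev_east ?sw ?lev0 //; lia.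
case: y {dw} sw bw p => // sw bw p; have := p (size v).+1.
have := lev_size bw; rewrite sw -sv addn2 lev_north ?sw; [|lia|]; last first.
  by rewrite /= nth_rcons ltnn eqxx.
by lia.
Qed.

Lemma swap_balanced v : balanced (north :: rcons v east) -> balanced (east :: rcons v north).
Proof.
rewrite (balanced_perm (u := east :: rcons v north)) //.
by apply/seq.permP => q; rewrite /= -!cats1 !count_cat /=; lia.
Qed.

(** The conjugate of [N v E] starts at the point of maximal level of the path and
    runs backwards. Its maximal level is reached where the path has level 0,
    between the first and the last step of the word [N v E], so removing the
    maximal box exchanges these two steps. Conjugating back only undoes the
    reversal and cuts the cycle elsewhere. *)
Lemma pred_path_rot v : dyck (north :: rcons v east) ->
  exists m, [/\ m <= a + b,
    pred_path a b (north :: rcons v east) = rot m (east :: rcons v north)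
    & dyck (pred_path a b (north :: rcons v east))].
Proof.
move=> dw; have bw := dyck_balanced dw; have := size_dyck dw; rewrite /= size_rcons => sv.
have [[|k] [kn cE kmax]] := conj_path_spec bw.
  have := kmax 1; rewrite lev_north // lev0; lia.
have dc := conj_path_dyck bw.
have kv : k <= size v by lia.
have rE x y : rot k.+1 (x :: rcons v y) = drop k v ++ [:: y; x] ++ take k v.
  rewrite /rot /= -cats1 drop_cat take_cat.
  case: ltngtP kv => // [kv _|-> _]; first by rewrite -catA.
  by rewrite subnn drop0 take0 cats0 drop_size take_size.
(* The [k.+1] steps of the path before its maximal point, reversed, lead the
   conjugate to the point where the path has level 0. *)
have mE : max_index a b (conj_path a b (north :: rcons v east)) = k.+1.
  have sc : size (conj_path a b (north :: rcons v east)) = a + b by exact: size_dyck.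
  set c := conj_path _ _ _ in dc sc cE *.
  have lc i : 0 < i <= a + b -> lev c i =
     (lev (north :: rcons v east) k.+1 -
      lev (north :: rcons v east) ((k.+1 + (a + b - i)) %% (a + b)))%R.
    move=> iw; rewrite cE lev_rev ?size_rot ?(size_dyck dw); [|
      by rewrite (balanced_perm (u := (north :: rcons v east))) ?perm_rot | lia].
    by rewrite lev_rot ?(size_dyck dw) //; [lia|lia|lia].
  pose q l := all (fun m => m <= l)%R (reading_word a b c).
  have hk : q (lev c k.+1).
    apply/allP => l /mapP[i]; rewrite mem_iota sc => iw ->; rewrite -/(lev c i).
    rewrite [lev c k.+1]lc; last lia.
    rewrite (_ : k.+1 + (a + b - k.+1) = a + b); last lia.
    rewrite modnn lev0; case: i iw => [_|i iw].
      by rewrite lev0; have := kmax 0; rewrite lev0; lia.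
    rewrite lc; last lia.
    have [_ p] := dyckP _ dw.
    by have := p ((k.+1 + (a + b - i.+1)) %% (a + b)); rewrite ltnW ?ltn_pmod; lia.
  have hq : has q (reading_word a b c).
    by apply/hasP; exists (lev c k.+1) => //; apply: map_f; rewrite mem_iota sc.
  have fn : max_index a b c < a + b.
    rewrite /max_index -[X in _ < X]sc -[X in _ < X](size_iota 0).
    by rewrite -(size_map (fun i => level a b (xcoord c i) (ycoord c i))) -has_find.
  have := nth_find 0%R hq; rewrite -/(max_index a b c) (nth_map 0) ?size_iota ?sc //.
  rewrite nth_iota ?sc // add0n -/(lev c _) => /allP A1.
  apply: (@lev_inj c) => //; apply/le_anti/andP; split.
    by apply: (allP hk); apply: map_f; rewrite mem_iota sc.
  by apply: A1; apply: (map_f (fun i => level a b (xcoord c i) (ycoord c i))); rewrite mem_iota sc.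
have rmE : remove_max_box a b (conj_path a b (north :: rcons v east)) =
    rev (rot k.+1 (east :: rcons v north)).
  have rv (l1 l2 : seq bool) x y : rev (l1 ++ [:: x; y] ++ l2) = rev l2 ++ [:: y; x] ++ rev l1.
    by rewrite !rev_cat -catA.
  have st : size (rev (take k v)) = k by rewrite size_rev size_takel.
  rewrite /remove_max_box mE cE !rE !rv -[k.+1.-1]/k take_size_cat //.
  by rewrite (_ : k.+2 = size (rev (take k v)) + 2) ?st ?addn2 // -addn2 -{2}st
    drop_cat ltnNge leq_addr /= addKn /= drop0.
have bu := swap_balanced bw.
have br : balanced (remove_max_box a b (conj_path a b (north :: rcons v east))).
  by rewrite rmE (balanced_perm (u := east :: rcons v north)) // perm_rev perm_rot.
have dp : dyck (pred_path a b (north :: rcons v east)) by apply: conj_path_dyck.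
have [j [jn jE _]] := conj_path_spec br.
have su : size (east :: rcons v north) = a + b by rewrite /= size_rcons.
have pE : pred_path a b (north :: rcons v east) = rotr j (rot k.+1 (east :: rcons v north)).
  by rewrite /pred_path jE rmE rev_rot revK.
move: pE; rewrite /rotr size_rot su rot_add_mod ?su ?leq_subr ?(ltnW kn) // => pE.
move: pE; set m := (X in rot X _) => pE.
by exists m; split=> //; rewrite /m; case: ifP; lia.
Qed.

Lemma pred_path_dyck w : dyck w -> dyck (pred_path a b w).
Proof. by move=> dw; have [v vE] := dyck_shape dw; subst w; have [m []] := pred_path_rot dw. Qed.

(** Iterating this conjugation produces [rho] as a product of the cycles
    [rho1]. *)
Lemma gamma_pred w : dyck w ->
  gamma w = (gamma (pred_path a b w) ^ rho1 (a + b) (delta w))%g.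
Proof.
move=> dw; have [v vE] := dyck_shape dw; subst w.
have [m [mn -> _]] := pred_path_rot dw; rewrite gamma_swap // gamma_rot //.
  exact/swap_balanced/dyck_balanced.
by have := size_dyck dw; rewrite /= !size_rcons => ->.
Qed.

(** Raising the origin by [a + b] leaves the maximal level unchanged, since it is
    at least [a + b], while the minimal level becomes positive and is then
    normalised to 0. *)
Lemma pred_path_bound K w : dyck w -> 0 < area a b w ->
  (forall i, i < a + b -> (lev w i <= K.+1%:Z)%R) ->
  forall i, i < a + b -> (lev (pred_path a b w) i <= K%:Z)%R.
Proof.
move=> dw /(area_gt0P dw)[i0 i0n l0] wK i iw; have [v vE] := dyck_shape dw; subst w.
have [m [mn -> _]] := pred_path_rot dw.
have bu := swap_balanced (dyck_balanced dw); have su := size_balanced bu.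
have sv := su; rewrite /= size_rcons in sv.
rewrite lev_rot ?su //.
have up j : j < a + b -> (lev (east :: rcons v north) j <= K.+1%:Z - (a + b)%:Z)%R.
  case: j => [|j] jn; first by have := wK _ i0n; rewrite lev0; lia.
  by rewrite lev_swap; [have := wK _ jn; lia | lia].
(* The minimal level after the exchange is above [- (a + b)], since only the
   origin had level 0. *)
have low : (1 - (a + b)%:Z <= lev (east :: rcons v north) m)%R.
  case: (ltngtP m (a + b)) mn => // [mn _|-> _]; last by rewrite -{2}su lev_size //; lia.
  case: m mn => [|m] mn; first by rewrite lev0; lia.
  by rewrite lev_swap; [have := @dyck_lev_gt0 _ m.+1 dw; lia | lia].
by have := up ((m + i) %% (a + b)); rewrite ltn_pmod; lia.
Qed.

(** * Paths of area 0 and induction along predecessors *)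

Lemma area0_lev w i : dyck w -> ~~ (0 < area a b w) -> i < a + b -> (lev w i < (a + b)%:Z)%R.
Proof.
move=> dw /(area_gt0P dw) ar iw; rewrite lt_neqAle leNgt; apply/andP; split; last first.
  by apply/negP => l; apply: ar; exists i.
apply/eqP => E; case: i iw E => [|i] iw E; first by move: E; rewrite lev0; lia.
suff: i.+1 = 0 by [].
apply: (@lev_inj_mod w) => //; [by lia | exact: size_dyck |].
by exists 1%R; rewrite lev0 E; lia.
Qed.

(** When all levels lie below [a + b], a north step can only leave a level below
    [a], and an east step only a level at least [a]. *)
Lemma area0_step w i : dyck w -> ~~ (0 < area a b w) -> i < a + b ->
  nth north w i = (lev w i < a%:Z)%R.
Proof.
move=> dw ar iw; have [bw p] := dyckP w dw.
have nn : i.+1 %% (a + b) < a + b by rewrite ltn_pmod; lia.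
have := area0_lev dw ar nn; have := p _ (ltnW nn); rewrite lev_next //.
by case: (nth _ _ _); lia.
Qed.

(** By [area0_step] the level of a point determines the next step. *)
Lemma area0_uniq w u : dyck w -> dyck u -> ~~ (0 < area a b w) -> ~~ (0 < area a b u) -> w = u.
Proof.
move=> dw du aw au; have sw := size_dyck dw; have su := size_dyck du.
have E i : i <= a + b -> lev w i = lev u i.
  elim: i => [|i IH] iw; first by rewrite !lev0.
  have := area0_step dw aw iw; have := area0_step du au iw; rewrite IH 1?ltnW // => nu nw.
  case N: (lev u i < a%:Z)%R nu nw => nu nw.
    by rewrite !lev_north ?sw ?su ?nu ?nw // IH // ltnW.
  by rewrite !lev_east ?sw ?su ?nu ?nw // IH // ltnW.
apply: (@eq_from_nth _ north); first by rewrite sw su.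
by move=> i; rewrite sw => iw; rewrite !area0_step // E // ltnW.
Qed.

(** By [area0_step], the [a] lowest points are those that north steps leave. *)
Lemma area0_exceedances w : dyck w -> ~~ (0 < area a b w) ->
  exceedances (gamma w) = nseq a north ++ nseq b east.
Proof.
move=> dw ar; have sw := size_dyck dw; have bw := dyck_balanced dw.
apply: (@eq_from_nth _ north); first by rewrite size_exceedances size_cat !size_nseq.
move=> r; rewrite size_exceedances => rn; have [|i iw ri] := @rank_onto w r.+1 sw; first by lia.
rewrite -[r]/(r.+1.-1) -ri nth_exceedances // area0_step //.
rewrite nth_cat size_nseq !nth_nseq ri /=.
have aE : count (fun j => (lev w j < a%:Z)%R) (iota 0 (a + b)) = a.
  transitivity (count_mem north w); last by case/andP: bw => /eqP.
  rewrite -[in RHS](mkseq_nth north w) /mkseq count_map sw.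
  by apply: eq_in_count => j; rewrite mem_iota => jw; rewrite /= -area0_step //; case: nth.
have rE : r = count (fun j => (lev w j < lev w i)%R) (iota 0 (a + b)).
  by move: ri; rewrite /rank sw => -[].
case: ltrP => li.
  suff -> : r < a by [].
  rewrite rE -[X in _ < X]aE; apply: (@count_ltn _ _ _ _ i); rewrite ?mem_iota ?ltxx // => j jl.
  exact: lt_trans jl li.
have -> : (r < a) = false; last by rewrite ifT //; lia.
apply/negbTE; rewrite -leqNgt.
rewrite rE -[X in X <= _]aE; apply: sub_count => j /= lj; exact: lt_le_trans lj li.
Qed.

(** In the induction, [delta] tells whether the diagonal path has been reached. *)
Lemma delta_area w : dyck w -> (delta w == a + b) = ~~ (0 < area a b w).
Proof.
move=> dw; rewrite deltaE ?size_dyck // -[X in _ == X](size_iota 0 (a + b)) -all_count.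
apply/allP/idP => [al|ar i]; last by rewrite mem_iota => iw; apply: area0_lev.
apply/negP => /(area_gt0P dw)[i iw li].
by have := al i; rewrite mem_iota => /(_ iw); lia.
Qed.

Lemma lev_bound w : exists K : nat, forall i, i < a + b -> (lev w i <= K%:Z)%R.
Proof.
have [k _ kmax] := ex_max_lev w; exists (absz (lev w k)) => i /kmax; lia.
Qed.

(** Induction on a bound for the levels. *)
Lemma dyck_pred_ind (T : seq bool -> Prop) :
  (forall w, dyck w -> ~~ (0 < area a b w) -> T w) ->
  (forall w, dyck w -> 0 < area a b w -> T (pred_path a b w) -> T w) ->
  forall w, dyck w -> T w.
Proof.
move=> T0 TS w dw; have [K] := lev_bound w; elim: K w dw => [|K IH] w dw wK.
  apply: T0 => //; apply/negP => /(area_gt0P dw)[i iw]; have := wK i iw; lia.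
have [ar|ar] := boolP (0 < area a b w); last exact: T0.
by apply: TS => //; apply: IH; [exact: pred_path_dyck | exact: pred_path_bound].
Qed.

Lemma diagonal_pathP : dyck (diagonal_path a b) /\ ~~ (0 < area a b (diagonal_path a b)).
Proof.
rewrite /diagonal_path; case: pickP => [w /andP[dw /eqP ->] //|no].
have : balanced (nseq a north ++ nseq b east).
  by rewrite /balanced !count_cat !count_nseq /= !(mul1n, mul0n) addn0 add0n !eqxx.
move/exceedances_dyck; elim/dyck_pred_ind => // w dw ar.
have sw : size w == a + b by rewrite size_dyck.
by have := no (Tuple sw); rewrite /= eqn0Ngt ar [_ \in _]dw.
Qed.

(** * From a path to its predecessor, on the side of zeta *)

(** The last step of a path leaves level [a], the lowest level that an east step
    can leave; so it is visible in the exceedances as their first east letter. *)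
Lemma index_exceedances w : dyck w -> (index east (exceedances (gamma w))).+1 = rank w (a + b).-1.
Proof.
move=> dw; have [bw p] := dyckP w dw; have sw := size_balanced bw.
have n1 : (a + b).-1 < a + b by lia.
set q := exceedances _; have [v vE] := dyck_shape dw.
have el : ~~ nth north w (a + b).-1.
  have := sw; rewrite vE /= size_rcons => <- /=.
  by rewrite nth_rcons ltnn eqxx.
have ll : lev w (a + b).-1 = a.
  have L : (a + b).-1 < size w by rewrite sw.
  have := lev_east L el; rewrite prednK ?addn_gt0 ?a_gt0 //.
  by rewrite -[in lev w (a + b)]sw lev_size //; lia.
have rb := rank_bound sw n1.
have qr : ~~ nth north q (rank w (a + b).-1).-1 by rewrite nth_exceedances.
have he : has (pred1 east) q.
  apply/hasP; exists east => //; apply/(nthP north).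
  by exists (rank w (a + b).-1).-1; [rewrite size_exceedances; lia | rewrite (negbTE qr)].
have ix : index east q < a + b by rewrite -(size_exceedances (gamma w)) -has_find.
have [|i iw ri] := @rank_onto w (index east q).+1 sw; first by lia.
have ei : ~~ nth north w i.
  by rewrite -nth_exceedances // ri /=; have := nth_find north he; rewrite -/(index east q) => /eqP ->.
have li : (lev w (a + b).-1 <= lev w i)%R.
  have nn : i.+1 %% (a + b) < a + b by rewrite ltn_pmod; lia.
  by have := p _ (ltnW nn); rewrite lev_next // (negbTE ei) ll; lia.
apply/eqP; rewrite eqn_leq; apply/andP; split; last first.
  by rewrite -ri leqNgt rank_ltE ?sw // -leNgt.
rewrite ltnNge; apply/negP => rl.
have lt : (rank w (a + b).-1).-1 < find (pred1 east) q by rewrite -/(index east q); lia.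
by have := before_find north lt; rewrite /= (negbTE qr).
Qed.

(** The exceedances of the predecessor, from those of the path and [delta]: the
    raised point is left by an east step, the former last east step has become a
    north step, and the other letters move with the ranks. *)
Definition pred_exceedances (q : seq bool) (d : nat) : seq bool :=
  [seq if r == d then east
       else (rho_val d r == (index east q).+1) || nth north q (rho_val d r).-1
     | r <- iota 1 (a + b)].

Lemma exceedances_pred w : dyck w ->
  exceedances (gamma (pred_path a b w)) = pred_exceedances (exceedances (gamma w)) (delta w).
Proof.
move=> dw; have [v vE] := dyck_shape dw; subst w.
have [m [mn -> _]] := pred_path_rot dw.
have bu := swap_balanced (dyck_balanced dw); have su := size_balanced bu.
have bw := dyck_balanced dw; have sw := size_balanced bw.
have sv := su; rewrite /= size_rcons in sv.
rewrite gamma_rot ?su //; apply: (@eq_from_nth _ north).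
  by rewrite size_exceedances size_map size_iota.
move=> r; rewrite size_exceedances => rn; have [|i iw ri] := @rank_onto _ r.+1 su; first by lia.
have -> : nth north (exceedances (gamma (east :: rcons v north))) r =
    nth north (east :: rcons v north) i.
  by rewrite -(nth_exceedances bu) // ri.
rewrite (nth_map 0) ?size_iota // nth_iota // add1n -ri.
rewrite index_exceedances // -rank_swap //.
rewrite -rank_swap0 //; case: i iw ri => [|i] iw ri; first by rewrite eqxx.
have n0 : 0 < a + b by lia.
have n1 : (a + b).-1 < a + b by lia.
rewrite ifF; last by apply/eqP => /(rank_inj su iw n0).
rewrite nth_exceedances //=; case: eqP => [/(rank_inj sw iw n1) E|ne] /=.
  have -> : i = size v by lia.
  by rewrite nth_rcons ltnn eqxx.
have iv : i < size v.
  by move: iw; rewrite -sv ltnS leq_eqVlt => /orP[/eqP E|//]; case: ne; rewrite E; congr rank; lia.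
by rewrite !nth_rcons iv.
Qed.

(** * Recovering a path from its permutation *)

(** The cycle is read from 1, the rank of the starting point of level 0. *)
Lemma cycle_notation_gamma w : dyck w -> cycle_notation (gamma w) = reading_perm a b w.
Proof.
move=> dw; have sw := size_dyck dw.
apply: (@eq_from_nth _ 0); first by rewrite size_map size_traject size_reading_perm sw.
rewrite size_map size_traject => i iw.
rewrite (nth_map (inord 1)) ?size_traject // nth_traject // nth_reading_perm ?sw //.
have -> : iter i (gamma w) (inord 1) = inord (rank w i).
  elim: i iw => [|i IH] iw; first by rewrite rank0.
  by rewrite iterS IH 1?ltnW // gamma_rank ?modn_small // ltnW.
by rewrite /= inordK // ltnS; case/andP: (rank_bound sw iw).
Qed.

Lemma nth_descent w i : dyck w -> i < a + b ->
  (nth north w i == east) = cyclic_descent (reading_perm a b w) i.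
Proof.
move=> dw iw; have bw := dyck_balanced dw; have sw := size_dyck dw.
have nn : i.+1 %% (a + b) < a + b by rewrite ltn_pmod; lia.
rewrite /cyclic_descent size_reading_perm sw !nth_reading_perm ?sw //.
rewrite rank_ltE ?sw // lev_next //.
by case: (nth _ _ _) => /=; lia.
Qed.

Lemma gamma_inj w u : dyck w -> dyck u -> gamma w = gamma u -> w = u.
Proof.
move=> dw du E; apply: (@eq_from_nth _ north); first by rewrite !size_dyck.
move=> i; rewrite size_dyck // => iw.
have : (nth north w i == east) = (nth north u i == east).
  by rewrite !nth_descent // -!cycle_notation_gamma // E.
by case: (nth _ w _); case: (nth _ u _).
Qed.

(** By induction on the predecessors of [w]: equal exceedances force equal
    predecessors, hence equal permutations. *)
Lemma exceedances_gamma_inj :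
  (forall w u, dyck w -> dyck u -> exceedances (gamma w) = exceedances (gamma u) ->
    delta w = delta u) ->
  forall w u, dyck w -> dyck u -> exceedances (gamma w) = exceedances (gamma u) -> w = u.
Proof.
move=> det w u dw; elim/dyck_pred_ind: w / dw u => [w dw aw|w dw aw IH] u du E.
  by apply: area0_uniq => //; rewrite -delta_area // -(det w u) // delta_area.
have dE := det w u dw du E.
have pE : pred_path a b w = pred_path a b u.
  by apply: IH; [exact: pred_path_dyck | rewrite !exceedances_pred // E dE].
by apply: gamma_inj => //; rewrite (gamma_pred dw) (gamma_pred du) pE dE.
Qed.

(** The function [d] stands for [delta] composed with the inverse of zeta. *)
Lemma zeta_predecessors_gamma (d : seq bool -> nat) :
  (forall w, dyck w -> zeta a b w = exceedances (gamma w)) ->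
  (forall w, dyck w -> d (zeta a b w) = delta w) ->
  forall w, dyck w -> exists Qs : seq (seq bool),
    [/\ zeta_predecessors a b w Qs,
        nth [::] Qs 0 = zeta a b w,
        nth [::] Qs (size Qs).-1 = nseq a north ++ nseq b east
      & gamma w = (gamma (diagonal_path a b) ^
          \big[@perm_comp (a + b).+1/1%g]_(0 <= i < (size Qs).-1)
            rho1 (a + b) (d (nth [::] Qs i)))%g].
Proof.
move=> zE dE; have [dd ad] := diagonal_pathP.
apply: dyck_pred_ind => [w dw aw|w dw aw [Qs [Q1 Q2 Q3 Q4]]].
  rewrite (area0_uniq dw dd aw ad); exists [:: zeta a b (diagonal_path a b)]; split=> //=.
  - exact: zeta_predecessors_diag.
  - by rewrite zE // area0_exceedances.
  - by rewrite big_nil conjg1.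
have Qs_gt0 : 0 < size Qs by case: Q1.
exists (zeta a b w :: Qs); split=> //=; first exact: zeta_predecessors_step.
  by case: Qs Qs_gt0 Q3 {Q1 Q2 Q4}.
rewrite -(prednK Qs_gt0) /=.
by rewrite big_nat_recl //= /perm_comp conjgM -Q4 dE // -gamma_pred.
Qed.

(** * Zeta records the exceedances of gamma *)

Definition easts_before w j : nat :=
  count (fun i => ~~ nth north w i && (lev w i < lev w j)%R) (iota 0 (a + b)).

(** The level one unit to the right of the [i]-th point. For a north step it is
    the hook of the leftmost box of its row below the path, if positive; for an
    east step it is the level of its endpoint, the smallest nonnegative number of its class modulo
    [b] that is not a hook (see [right_hook_gap] and [right_hook_not_mem]). *)
Definition right_hook w i : nat := absz (lev w i - Posz a)%R.

Lemma right_hookE w i : (a%:Z <= lev w i)%R -> right_hook w i + a * (xcoord w i).+1 = b * ycoord w i.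
Proof. by rewrite /right_hook /lev /level; lia. Qed.

Lemma lev_east_ge w i : dyck w -> i < a + b -> ~~ nth north w i -> (a%:Z <= lev w i)%R.
Proof.
move=> dw iw ei; have [bw p] := dyckP w dw.
have nn : i.+1 %% (a + b) < a + b by rewrite ltn_pmod; lia.
by have := p _ (ltnW nn); rewrite lev_next // (negbTE ei); lia.
Qed.

Lemma east_inj w i j : size w = a + b -> i < a + b -> j < a + b ->
  ~~ nth north w i -> ~~ nth north w j -> xcoord w i = xcoord w j -> i = j.
Proof.
move=> sw.
have lt k l : k < a + b -> k < l -> ~~ nth north w k -> xcoord w k < xcoord w l.
  move=> kw kl ek; have [|S _] := @coordS w k; first by rewrite sw.
  by have [] := coord_mono w kl; rewrite S (negbTE ek) addn1.
move=> iw jw ei ej E; case: (ltngtP i j) => // [ij|ji].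
  by have := lt i j iw ij ei; rewrite E ltnn.
by have := lt j i jw ji ej; rewrite E ltnn.
Qed.

Lemma xcoord_lt w i : balanced w -> i < a + b -> ~~ nth north w i -> xcoord w i < b.
Proof.
move=> bw iw ei; have [|S _] := @coordS w i; first by rewrite (size_balanced bw).
have [xe _] := coord_end bw.
by have [] := coord_mono w iw; rewrite S xe (negbTE ei) addn1.
Qed.

Lemma ycoord_le w i : balanced w -> i <= a + b -> ycoord w i <= a.
Proof. by move=> bw iw; have [_ <-] := coord_end bw; have [] := coord_mono w iw. Qed.

Lemma north_lt w i j : size w = a + b -> j < a + b -> nth north w j ->
  (ycoord w j < ycoord w i) = (j < i).
Proof.
move=> sw jw nj; have [|_ S] := @coordS w j; first by rewrite sw.
case: (leqP i j) => ij.
  by apply/negbTE; rewrite -leqNgt; case: (coord_mono w ij).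
by have [_] := coord_mono w ij; rewrite S nj addn1.
Qed.

(** By coprimality the diagonal meets no lattice point inside the grid. *)
Lemma no_zero_hook x y : y < a -> b * y <> a * x.+1.
Proof.
move=> ya E; suff y0 : y = 0 by move: E; rewrite y0; lia.
by apply: (coprime_cancel coprime_ab ya a_gt0); exists (Posz x.+1); lia.
Qed.

(** Going down a column from the endpoint of its east step, the levels decrease by
    [b]; they are hooks as long as they are nonnegative, and 0 does not occur. *)
Lemma right_hook_gap w i g : dyck w -> i < a + b -> ~~ nth north w i ->
  (exists t, right_hook w i = g + b * t.+1) -> g \in positive_hooks a b w.
Proof.
move=> dw iw ei [t gE]; have bw := dyck_balanced dw.
have hE := right_hookE (lev_east_ge dw iw ei).
have yl := ycoord_le bw (ltnW iw).
have E : g + a * (xcoord w i).+1 = b * (ycoord w i - t.+1).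
  by rewrite mulnBr -hE gE; lia.
have g0 : 0 < g.
  rewrite lt0n; apply/eqP => g0; apply: (@no_zero_hook (xcoord w i) (ycoord w i - t.+1)); last first.
    by rewrite -E g0.
  have : 0 < ycoord w i by rewrite lt0n; apply/eqP => y0; move: E; rewrite y0 sub0n muln0; lia.
  by lia.
apply/(positive_hooksP _ dw); split=> //.
exists i, (ycoord w i - t.+1); split=> //.
have : 0 < ycoord w i - t.+1 by rewrite lt0n; apply/eqP => y0; move: E; rewrite y0 muln0; lia.
by lia.
Qed.

Lemma right_hook_inj w i k (z : int) : dyck w -> i < a + b -> k < a + b ->
  ~~ nth north w i -> ~~ nth north w k ->
  ((right_hook w i)%:Z = (right_hook w k)%:Z + z * b%:Z)%R -> i = k.
Proof.
move=> dw iw kw ei ek E; have bw := dyck_balanced dw.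
apply: (east_inj (size_dyck dw)) => //.
have hi := right_hookE (lev_east_ge dw iw ei); have hk := right_hookE (lev_east_ge dw kw ek).
have cba : coprime b a by rewrite coprime_sym.
apply: (coprime_cancel cba); rewrite ?xcoord_lt //.
by exists ((ycoord w i)%:Z - (ycoord w k)%:Z - z)%R; lia.
Qed.

(** Distinct columns give distinct classes modulo [b], so a hook of this class
    would be the hook of a box above the path. *)
Lemma right_hook_not_mem w i t : dyck w -> i < a + b -> ~~ nth north w i ->
  right_hook w i + b * t \notin positive_hooks a b w.
Proof.
move=> dw iw ei; have bw := dyck_balanced dw; have sw := size_balanced bw.
apply/negP => /(positive_hooksP _ dw)[_ [k [y [kw ek yk E]]]].
have hE := right_hookE (lev_east_ge dw iw ei).
have xE : xcoord w k = xcoord w i.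
  have cba : coprime b a by rewrite coprime_sym.
  apply: (coprime_cancel cba); rewrite ?xcoord_lt //.
  by exists (y%:Z - t%:Z - (ycoord w i)%:Z)%R; lia.
have ki := east_inj sw kw iw ek ei xE; subst k.
by nia.
Qed.

(** The [b] east steps give [b] distinct classes modulo [b]. *)
Lemma east_residue w g : dyck w ->
  exists2 i, i < a + b /\ ~~ nth north w i & right_hook w i = g %[mod b].
Proof.
move=> dw; have bw := dyck_balanced dw; have sw := size_balanced bw.
pose es := [seq i <- iota 0 (a + b) | ~~ nth north w i].
have esP i : i \in es -> i < a + b /\ ~~ nth north w i.
  by rewrite mem_filter mem_iota => /andP[-> /andP[_ ->]].
have se : size es = b.
  rewrite size_filter; transitivity (count_mem east w); last by case/andP: bw => _ /eqP.
  rewrite -[in RHS](mkseq_nth north w) /mkseq count_map sw.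
  by apply: eq_count => j /=; rewrite eqbF_neg.
pose rs := [seq right_hook w i %% b | i <- es].
have ur : uniq rs.
  rewrite map_inj_in_uniq ?filter_uniq ?iota_uniq // => i j /esP[iw ei] /esP[jw ej] E.
  apply: (right_hook_inj dw iw jw ei ej (z := (right_hook w i %/ b)%:Z - (right_hook w j %/ b)%:Z)%R).
  by rewrite {1}(divn_eq (right_hook w i) b) {1}(divn_eq (right_hook w j) b) E; lia.
have [_ rE] : (size rs = size (iota 0 b)) * (rs =i iota 0 b).
  apply: uniq_min_size => //; last by rewrite size_map se size_iota.
  by move=> r /mapP[i _ ->]; rewrite mem_iota ltn_pmod.
have : g %% b \in rs by rewrite rE mem_iota ltn_pmod.
by case/mapP=> i /esP ? ->; exists i.
Qed.

(** The box to the right of a north step lies under the east step [i] of its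
    column, at a distance of [s + 1] boxes. *)
Lemma right_hook_north w j : dyck w -> j < a + b -> nth north w j -> (a%:Z < lev w j)%R ->
  exists i s, [/\ j < i < a + b, ~~ nth north w i, xcoord w i = xcoord w j
    & right_hook w i = right_hook w j + b * s.+1].
Proof.
move=> dw jw nj lj; have bw := dyck_balanced dw; have sw := size_balanced bw.
have hj := right_hookE (ltW lj); have yj := ycoord_le bw (ltnW jw).
have xb : xcoord w j < b by rewrite ltnNge; apply/negP => bx; move: lj hj; nia.
have [|i [iw ei xi]] := @ex_step w east (xcoord w j); first by case/andP: bw => _ /eqP ->.
have {}ei : ~~ nth north w i by rewrite ei.
rewrite -/(xcoord w i) in xi; rewrite sw in iw.
have ji : j < i.
  rewrite ltnNge; apply/negP; rewrite leq_eqVlt => /orP[/eqP E|ij]; first by rewrite E nj in ei.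
  have [|S _] := @coordS w i; first by rewrite sw.
  by have [] := coord_mono w ij; rewrite S (negbTE ei) xi addn1 ltnn.
have := ji; rewrite -(north_lt i sw jw nj) => yl.
exists i, (ycoord w i - (ycoord w j).+1); split=> //; first by rewrite ji.
have := right_hookE (lev_east_ge dw iw ei); rewrite xi.
by rewrite -[in b * ycoord w i](subnK yl) mulnDr mulnS; lia.
Qed.

(** The east steps that start below the north step [j] correspond to the gaps of
    the window of [b] numbers just below the hook of [j]: to an east step
    corresponds the member of its class modulo [b] in the window. *)
Lemma gap_count w j : dyck w -> j < a + b -> nth north w j -> (a%:Z < lev w j)%R ->
  count (fun g => (g \notin positive_hooks a b w) && (right_hook w j < g + b))
    (iota 0 (right_hook w j)) =
  easts_before w j.
Proof.
move=> dw jw nj lj; have bw := dyck_balanced dw; have sw := size_balanced bw.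
have [k [s [/andP[jk kw] ek _ hk]]] := right_hook_north dw jw nj lj.
set h := right_hook w j in hk *.
have ltE i : i < a + b -> ~~ nth north w i -> (lev w i < lev w j)%R = (right_hook w i < h).
  by move=> iw ei; have := lev_east_ge dw iw ei; rewrite /h /right_hook; lia.
(* The representative, in the window just below [h], of the class of [i]. *)
pose phi i := right_hook w i + b * ((h.-1 - right_hook w i) %/ b).
have phiP i : right_hook w i < h -> phi i < h <= phi i + b.
  move=> ih; have := divn_eq (h.-1 - right_hook w i) b; have := ltn_pmod (h.-1 - right_hook w i) b_gt0.
  by rewrite /phi; lia.
rewrite /easts_before -!size_filter; set gs := filter _ (iota 0 h); set es := filter _ _.
have esP i : i \in es -> [/\ i < a + b, ~~ nth north w i & right_hook w i < h].
  rewrite mem_filter mem_iota => /andP[/andP[ei li] /andP[_ iw]].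
  by split=> //; rewrite -ltE.
rewrite -(size_map phi es); apply/perm_size/uniq_perm.
- by rewrite filter_uniq ?iota_uniq.
- rewrite map_inj_in_uniq ?filter_uniq ?iota_uniq // => i i' /esP[iw ei _] /esP[iw' ei' _].
  rewrite /phi => E; apply: (right_hook_inj dw iw iw' ei ei').
  by instantiate (1 := (((h.-1 - right_hook w i') %/ b)%:Z -
    ((h.-1 - right_hook w i) %/ b)%:Z)%R); lia.
move=> g; rewrite mem_filter mem_iota add0n; apply/idP/mapP.
  case/andP=> /andP[gH hg] /andP[_ gh].
  have [i [iw ei] iE] := east_residue g dw.
  have ig : right_hook w i <= g.
    rewrite leqNgt; apply/negP => gi; case/negP: gH; apply: (right_hook_gap dw iw ei).
    have := divn_eq (right_hook w i) b; have := divn_eq g b; rewrite iE => gE iE'.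
    exists (right_hook w i %/ b - g %/ b).-1; have : g %/ b < right_hook w i %/ b by nia.
    by nia.
  exists i; first by rewrite mem_filter mem_iota ei iw ltE // (leq_ltn_trans ig).
  by rewrite /phi (round_mod ig gh hg iE).
case=> i /esP[iw ei ih] ->; have /andP[ph hp] := phiP i ih.
rewrite ph right_hook_not_mem // leq0n /= ltn_neqAle hp !andbT.
(* If [h - b] were in the class of [i], then so would [h], and [i] would be the
   east step [k] above the north step; but that one starts higher. *)
apply/eqP => E; have ik : i = k; last by subst k; move: ih hk; lia.
apply: (right_hook_inj dw iw kw ei ek (z := - (s.+1 + ((h.-1 - right_hook w i) %/ b).+1)%:Z)%R).
by move: E hk; rewrite /phi; lia.
Qed.

Lemma positive_hooks_uniq w : uniq (positive_hooks a b w).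
Proof.
rewrite map_inj_in_uniq.
  by apply/filter_uniq/allpairs_uniq; rewrite ?iota_uniq // => -[? ?] [? ?] _ _ [-> ->].
have bnd x y : (x, y) \in [seq (x, y) | x <- iota 1 b, y <- iota 0 a] -> y < a.
  by case/allpairsP=> -[x' y'] /= [_ + [_ ->]]; rewrite mem_iota.
move=> [x y] [x' y']; rewrite !mem_filter /=.
move=> /andP[/andP[_ l] /bnd ya] /andP[/andP[_ l'] /bnd ya'] E.
have yy : y = y'.
  apply: (coprime_cancel coprime_ab); [exact: ya | exact: ya' |].
  by exists (x%:Z - x'%:Z)%R; move: E l l'; rewrite /level; lia.
by subst y'; congr (_, _); move: E l l'; rewrite /level; nia.
Qed.

(** Hooks of the same row are those congruent modulo [a], and they decrease by [a]
    from left to right; so the largest belongs to the box next to the north step. *)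
Lemma mrow_right_hook w h : dyck w ->
  (h \in positive_hooks a b w) &&
    all (fun h' => (h' == h %[mod a]) ==> (h' <= h)) (positive_hooks a b w) =
  (h \in [seq right_hook w j | j <- iota 0 (a + b) & nth north w j && (a%:Z < lev w j)%R]).
Proof.
move=> dw; have bw := dyck_balanced dw; have sw := size_balanced bw.
have nhook j : j < a + b -> nth north w j -> (a%:Z < lev w j)%R ->
    right_hook w j \in positive_hooks a b w.
  move=> jw nj lj; have [i [s [/andP[_ iw] ei _ hi]]] := right_hook_north dw jw nj lj.
  by apply: (right_hook_gap dw iw ei); exists s.
apply/andP/mapP => [[/(positive_hooksP _ dw)[h0 [i [y [iw ei yi E]]]] /allP hmax]|].
  have [|j [jw nj yj]] := @ex_step w north y.
    case/andP: bw => /eqP -> _; apply: leq_trans (yi) _.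
    exact: ycoord_le (dyck_balanced dw) (ltnW iw).
  rewrite -/(ycoord w j) in yj; rewrite sw in jw.
  have ji : j < i by rewrite -(north_lt i sw jw nj) yj.
  have [xji _] := coord_mono w (ltnW ji).
  have lj : (a%:Z < lev w j)%R by rewrite /lev /level yj; nia.
  have hj := right_hookE (ltW lj).
  exists j; first by rewrite mem_filter nj lj mem_iota.
  have /implyP := hmax _ (nhook j jw nj lj).
  have hE : right_hook w j = (xcoord w i - xcoord w j) * a + h by move: hj; rewrite yj; nia.
  rewrite hE modnMDl eqxx => /(_ isT); rewrite -hE.
  have : h <= right_hook w j by rewrite hE leq_addl.
  by lia.
case=> j; rewrite mem_filter mem_iota => /andP[/andP[nj lj] /andP[_ jw]] ->.
split; first exact: nhook.
apply/allP => h' /(positive_hooksP _ dw)[h0 [i [y [iw ei yi E]]]]; apply/implyP => /eqP hh.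
have hj := right_hookE (ltW lj).
have [|_ S] := @coordS w j; first by rewrite sw.
have yj : ycoord w j < a.
  by have := ycoord_le bw jw; rewrite S nj addn1.
have yE : y = ycoord w j.
  apply: (coprime_cancel coprime_ab) => //; first exact: leq_trans yi (ycoord_le bw (ltnW iw)).
  exists ((h' %/ a)%:Z + (xcoord w i)%:Z - (right_hook w j %/ a)%:Z - (xcoord w j)%:Z)%R.
  by have := divn_eq h' a; have := divn_eq (right_hook w j) a; rewrite hh; lia.
have ji : j < i by rewrite -(north_lt i sw jw nj) -yE.
have [xji _] := coord_mono w (ltnW ji).
by move: E hj; rewrite yE; nia.
Qed.

(** The letters before that of step [j] belong to the steps that start lower. *)
Lemma xcoord_exceedances w j : dyck w -> j < a + b ->
  xcoord (exceedances (gamma w)) (rank w j).-1 = easts_before w j.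
Proof.
move=> dw jw; have bw := dyck_balanced dw; have sw := size_balanced bw.
have rj := rank_bound sw jw.
rewrite /xcoord count_exceedances //; last by lia.
apply: eq_in_count => i; rewrite mem_iota add0n => /= iw.
have -> : (rank w i <= (rank w j).-1) = (rank w i < rank w j) by lia.
by rewrite rank_ltE ?sw // andbC eqbF_neg.
Qed.

(** Both sides are weakly decreasing, so they are compared as multisets. The parts
    of the [a]-rows are given by the north steps with a positive hook on their
    right; the other north steps start at level at most [a], where no east step
    starts lower, and account for the zeros. *)
Lemma lambda_exceedances w : dyck w ->
  lambda a b w = rev [seq xcoord (exceedances (gamma w)) k
    | k <- iota 0 (a + b) & nth north (exceedances (gamma w)) k].
Proof.
move=> dw; have bw := dyck_balanced dw; have sw := size_balanced bw.
rewrite /lambda; set parts := map _ _.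
have g_tr : transitive geq by move=> x y z /= xy yz; exact: leq_trans yz xy.
have g_as : antisymmetric geq by move=> x y /= /andP[xy yx]; apply/eqP; rewrite eqn_leq xy yx.
have g_tot : total geq by move=> x y; exact: leq_total.
apply: (sorted_eq g_tr g_as); first exact: sort_sorted.
  rewrite rev_sorted; apply: (homo_sorted (e := ltn)).
    by move=> k l kl; case: (coord_mono (exceedances (gamma w)) (ltnW kl)).
  by apply: sorted_filter; [exact: ltn_trans | exact: iota_ltn_sorted].
rewrite perm_sort perm_sym perm_rev.
set PH := positive_hooks a b w.
pose H := sort geq PH.
have HP : H =i PH by move=> h; rewrite mem_sort.
have sH : sorted gtn H.
  by rewrite gtn_sorted_uniq_geq sort_uniq positive_hooks_uniq sort_sorted.
have pH : all (ltn 0) H.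
  by apply/allP => h; rewrite HP => /(positive_hooksP _ dw)[].
pose F h := count (fun g => (g \notin PH) && (h < g + b)) (iota 0 h).
pose amax h := all (fun h' => (h' == h %[mod a]) ==> (h' <= h)) PH.
have pE : parts = [seq F h | h <- H & amax h].
  rewrite /parts /core -/PH -/H size_partition_of_hooks.
  rewrite -[in RHS](mkseq_nth 0 H) /mkseq filter_map -map_comp.
  have -> : [seq i <- iota 0 (size H) | is_mrow a (partition_of_hooks H) i] =
      [seq i <- iota 0 (size H) | preim (nth 0 H) amax i].
    apply: eq_filter => i; rewrite /is_mrow partition_of_hooksK //=.
    exact: eq_all_r.
  apply/eq_in_map => i; rewrite mem_filter mem_iota => /andP[_ /andP[_ iH]].
  rewrite mboundary_gaps //= /F; apply: eq_count => g /=.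
  by rewrite HP.
pose ns := [seq j <- iota 0 (a + b) | nth north w j].
have perm_parts : perm_eq parts [seq easts_before w j | j <- ns & (a%:Z < lev w j)%R].
  have -> : [seq easts_before w j | j <- ns & (a%:Z < lev w j)%R] =
     [seq F h | h <- [seq right_hook w j | j <- ns & (a%:Z < lev w j)%R]].
    rewrite -map_comp; apply/eq_in_map => j; rewrite !mem_filter mem_iota => /and4P[lj nj _ jw].
    by rewrite /= /F gap_count.
  rewrite pE perm_map //; apply: uniq_perm.
  - by rewrite filter_uniq // sort_uniq positive_hooks_uniq.
  - rewrite map_inj_in_uniq ?filter_uniq ?iota_uniq // => i j.
    rewrite !mem_filter !mem_iota => /and4P[li _ _ iw] /and4P[lj _ _ jw] E.
    by apply: (@lev_inj w) => //; move: E; rewrite /right_hook; lia.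
  move=> h; rewrite mem_filter HP andbC /amax mrow_right_hook // -filter_predI.
  by congr (h \in map _ _); apply: eq_filter => j /=; rewrite andbC.
have ns_size : size ns = a.
  rewrite size_filter; transitivity (count_mem north w); last by case/andP: bw => /eqP.
  rewrite -[in RHS](mkseq_nth north w) /mkseq count_map sw.
  by apply: eq_count => j /=; rewrite eqb_id.
have perm_all : perm_eq (parts ++ nseq (a - size parts) 0) [seq easts_before w j | j <- ns].
  have pns := perm_filterC (fun j => (a%:Z < lev w j)%R) ns.
  rewrite perm_sym -(permPl (perm_map (easts_before w) (introT permPl pns))) map_cat.
  rewrite perm_sym; apply: perm_cat => //.
  have z : all (pred1 0) [seq easts_before w j | j <- ns & predC (fun j => (a%:Z < lev w j)%R) j].
    apply/allP => c /mapP[j]; rewrite mem_filter /= -leNgt => /andP[lj _] -> /=.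
    rewrite /easts_before (@eq_in_count _ _ pred0) ?count_pred0 // => i; rewrite mem_iota => /= iw.
    by apply/negP => /andP[ei]; have := lev_east_ge dw iw ei; lia.
  rewrite (all_pred1P _ _ z) (perm_size perm_parts) !size_map !size_filter.
  rewrite [nseq (a - _) _](_ : _ = nseq (count (predC (fun j => (a%:Z < lev w j)%R)) ns) 0) //.
  congr nseq; rewrite -[X in X - _]ns_size -(count_predC (fun j => (a%:Z < lev w j)%R) ns).
  by rewrite addKn.
rewrite perm_sym (permPl perm_all).
have pi : perm_eq (iota 0 (a + b)) [seq (rank w j).-1 | j <- iota 0 (a + b)].
  have E : [seq r.-1 | r <- iota 1 (a + b)] = iota 0 (a + b).
    by rewrite -[1]/(1 + 0) iotaDl -map_comp map_id.
  have := perm_map predn (reading_perm_iota sw).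
  by rewrite reading_permE sw -map_comp E perm_sym.
rewrite perm_sym (permPl (perm_map _ (perm_filter _ pi))) filter_map -map_comp /ns.
rewrite (@eq_in_filter _ _ (nth north w)); last first.
  by move=> j; rewrite mem_iota => /= jw; rewrite nth_exceedances.
apply: (eq_ind_r (fun s => perm_eq s _) (perm_refl _)); apply/eq_in_map => j.
by rewrite mem_filter mem_iota => /and3P[_ _ jw] /=; apply: xcoord_exceedances.
Qed.

Lemma zeta_exceedances w : dyck w -> zeta a b w = exceedances (gamma w).
Proof.
move=> dw; have /andP[_ /eqP eb] := exceedances_balanced (dyck_balanced dw).
by rewrite /zeta lambda_exceedances // -[b in path_below b]eb -(size_exceedances (gamma w))
  path_below_easts.
Qed.

(** * The inverse of zeta *)

Definition zeta_inv (Q : seq bool) : seq bool :=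
  if [pick w : (a + b).-tuple bool | dyck w && (zeta a b w == Q)] is Some w
  then tval w else [::].

(** An injective map of a finite set into itself is surjective. *)
Lemma zeta_inv_spec :
  (forall w u, dyck w -> dyck u -> zeta a b w = zeta a b u -> w = u) ->
  forall Q, dyck Q -> dyck (zeta_inv Q) /\ zeta a b (zeta_inv Q) = Q.
Proof.
move=> inj Q dQ; rewrite /zeta_inv.
case: pickP => [w /andP[dw /eqP E] //|no].
pose D := [set w : (a + b).-tuple bool | dyck w].
pose f (w : (a + b).-tuple bool) := Tuple (introT eqP (size_exceedances (gamma w))).
have fD : f @: D = D.
  apply/eqP; rewrite eqEcard card_in_imset ?leqnn ?andbT.
    apply/subsetP => u /imsetP[w]; rewrite !inE => dw ->.
    exact/exceedances_dyck/dyck_balanced.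
  move=> w u; rewrite !inE => dw du /(congr1 val) /= E; apply: val_inj.
  by apply: inj => //; rewrite !zeta_exceedances.
have sQ : size Q == a + b by rewrite size_dyck.
have : Tuple sQ \in f @: D by rewrite fD inE.
case/imsetP=> w; rewrite inE => dw /(congr1 val) /= E.
by have := no w; rewrite dw zeta_exceedances // E eqxx.
Qed.
End RationalDyckPaths.

Theorem theorem9p2 (a b : nat) (a_gt0 : 0 < a) (b_gt0 : 0 < b)
  (coprime_ab : coprime a b)
  (delta_determined : forall P P' : seq bool,
     P \in dyck_paths a b -> P' \in dyck_paths a b ->
     zeta a b P = zeta a b P' -> delta a b P = delta a b P') :
  exists zeta_inv : seq bool -> seq bool,
    [/\ (forall P, P \in dyck_paths a b -> zeta a b P \in dyck_paths a b),
        (forall Q, Q \in dyck_paths a b -> zeta_inv Q \in dyck_paths a b),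
        (forall P, P \in dyck_paths a b -> zeta_inv (zeta a b P) = P),
        (forall Q, Q \in dyck_paths a b -> zeta a b (zeta_inv Q) = Q)
      & forall P Q, P \in dyck_paths a b -> Q = zeta a b P ->
        (exists Qs : seq (seq bool),
           [/\ zeta_predecessors a b P Qs,
               nth [::] Qs 0 = Q,
               nth [::] Qs (size Qs).-1 = nseq a north ++ nseq b east
             & let n := a + b in
               let delta_ i := delta a b (zeta_inv (nth [::] Qs i)) in
               let rho :=
                 \big[@perm_comp n.+1/1%g]_(0 <= i < (size Qs).-1)
                    rho1 n (delta_ i) in
               gamma a b P =
                 perm_comp (perm_comp rho (gamma a b (diagonal_path a b)))
                           rho^-1%g])
        /\ (let s := cycle_notation (gamma a b P) in
            [/\ perm_eq s (iota 1 (a + b)),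
                gamma a b P = cycle_perm (a + b) s
              & forall i, i < a + b ->
                  (nth north P i == east) = cyclic_descent s i])].
Proof.
have zE := zeta_exceedances a_gt0 b_gt0 coprime_ab.
have inj P P' : dyck_path a b P -> dyck_path a b P' -> zeta a b P = zeta a b P' -> P = P'.
  move=> dP dP'; rewrite !zE //.
  apply: (exceedances_gamma_inj a_gt0 b_gt0 coprime_ab) => // w u dw du.
  by rewrite -!zE //; apply: delta_determined.
have zeta_dyck P : dyck_path a b P -> dyck_path a b (zeta a b P).
  by move=> dP; rewrite zE //; apply/exceedances_dyck/dyck_balanced.
have invP := zeta_inv_spec a_gt0 b_gt0 coprime_ab inj.
have zetaK P : dyck_path a b P -> zeta_inv a b (zeta a b P) = P.
  by move=> dP; have [di iE] := invP _ (zeta_dyck P dP); apply: inj.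
exists (zeta_inv a b); split=> // [Q /invP[]|Q /invP[]|P Q dP ->] //; split.
  have [|Qs [Q1 Q2 Q3 Q4]] := @zeta_predecessors_gamma a b a_gt0 b_gt0 coprime_ab
      (fun Q => delta a b (zeta_inv a b Q)) zE _ P dP.
    by move=> w dw; rewrite zetaK.
  by exists Qs; split.
have sP := size_dyck dP.
rewrite (cycle_notation_gamma a_gt0 b_gt0 coprime_ab dP); split=> [||i] //.
  exact: reading_perm_iota.
exact: nth_descent.
Qed.
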